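(* Let $\mathcal{X}=[\underline{x},\overline{x}]$, $k\in(0,1)$, and let $\pi:\mathcal{X}\to\mathbb{R}$ be continuous. Consider the contest designer's problem of choosing an Allocation Rule $q$ (that is, $q:\mathcal{X}\times\Delta(\mathcal{X})\to[0,1]$, non-decreasing in its first argument, with $\int_{\mathcal{X}} q(x,\mu)\,d\mu(x)=k$ for every $\mu\in\Delta(\mathcal{X})$) to maximize $$\Pi(q)=\int_{\Delta(\mathcal{X})}\int_{\mathcal{X}} q(x^*,\mu)\,\pi(x^* )\,d\mu(x^* )\,d\mathbf{M}(\mu).$$ For any probability measure $\mathbf{M}$ on $(\Delta(\mathcal{X}),\mathcal{B}(\Delta(\mathcal{X})))$, the maximizers are as follows. (1) If $\pi$ is increasing, the optimal Allocation Rule is $$q^*(x,\mu)=\begin{cases}1 & x>\tilde{x}\\ 0 & x<\tilde{x},\end{cases}$$ where, for each $\mu\in\Delta(\mathcal{X})$, $\tilde{x}\in\mathcal{X}$ is the unique solution to $\int_{\mathcal{X}} q^*(x,\mu)\,d\mu(x)=k$. (2) If $\pi$ is decreasing, the optimal Allocation Rule is the constant rule $\bar{q}(x,\mu)=k$ for all $x\in\mathcal{X}$ and $\mu\in\Delta(\mathcal{X})$. (3) If $\pi$ is non-monotonic, the optimal Allocation Rule is $$q^*(x,\mu)=\begin{cases}1 & x>x''\\ \alpha & x'\le x\le x''\\ 0 & x<x'\end{cases}$$ for some $x',x''\in\mathcal{X}$ and $\alpha\in[0,1]$.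
   Context: $\Delta(\mathcal{X})$ is the set of Borel probability measures on $\mathcal{X}$ with the topology of weak convergence ($\mu_n\to\mu$ iff $\int g\,d\mu_n\to\int g\,d\mu$ for every continuous $g$), and $\mathcal{B}(\Delta(\mathcal{X}))$ is its Borel $\sigma$-algebra. There is a measure-one mass of agents; each chooses an effort $x\in\mathcal{X}$, and $\mu$ is the distribution of efforts (the competition) an agent faces. Effort is perfectly observable. An agent with effort $x$ wins a prize with probability $q(x,\mu)$ and has payoff $U(x)=q(x,\mu)u(V)-c(x)$, where $V$ is the prize, $u$ is continuous and non-decreasing, and $c$ is convex. In the designer's payoff, $x^*$ denotes the effort maximizing $U$, with $x^*$ integrated with respect to $\mu$. The value of the rule in case (1) at $x=\tilde x$ is whatever value in $[0,1]$ makes the constraint hold.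
   Formalization: In (1) x̃ need not be unique (μ=½δ₀+½δ₁, k=½): shown are existence and that two solutions give the same rule μ-a.e.; in (1),(2) the optimal rule is unique only up to null sets, for strictly monotone π; (3) asserts existence; ∫qπdμ is assumed Borel in μ. *)

(* Defs.v *)
From HB Require Import structures.
From mathcomp Require Import all_boot all_order all_algebra.
From mathcomp Require Import all_classical all_reals all_analysis.
From mathcomp Require Import measurable_realfun.

Set Implicit Arguments.
Unset Strict Implicit.
Unset Printing Implicit Defensive.

Import Order.TTheory GRing.Theory Num.Theory.
Import numFieldNormedType.Exports.

Local Open Scope classical_set_scope.
Local Open Scope ring_scope.

(* A Borel probability measure on [a, b] is encoded as a Borel probability
   measure on the real line giving mass one to [a, b]. The proof ab only serves
   to make the type inhabited, as required by measurableType. *)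
Record Delta (R : realType) (a b : R) (ab : a <= b) := MkDelta {
  Delta_prob :> probability (measurableTypeR R) R ;
  Delta_mass : Delta_prob (`[a, b]%classic) = 1%E }.

Section delta_pointed.
Context (R : realType) (a b : R) (ab : a <= b).

Lemma dirac_mass :
  (\d_(a : measurableTypeR R) : probability (measurableTypeR R) R)
    (`[a, b]%classic) = 1%E.
Proof. by rewrite /= diracE mem_set //= in_itv /= lexx ab. Qed.

HB.instance Definition _ := gen_eqMixin (Delta ab).
HB.instance Definition _ := gen_choiceMixin (Delta ab).
HB.instance Definition _ := isPointed.Build (Delta ab) (MkDelta ab dirac_mass).

End delta_pointed.

Section weak_convergence.
Context (R : realType) (a b : R) (ab : a <= b).

Definition test_fun := {g : R -> R | {within `[a, b], continuous g}}.

Definition test_integral (g : test_fun) (mu : Delta ab) : R :=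
  \int[mu]_(x in `[a, b]) sval g x.

(* The coarsest topology making mu |-> \int g d mu continuous for every
   continuous g on [a, b] *)
HB.instance Definition _ := Topological.copy (Delta ab)
  (sup_topology (fun g : test_fun =>
    Topological.class (initial_topology (test_integral g)))).

Lemma weak_cvgP (F : set_system (Delta ab)) (mu : Delta ab) : Filter F ->
  F --> mu <->
  forall g : test_fun, test_integral g @ F --> test_integral g mu.
Proof.
move=> FF; split => [/cvg_sup Fmu g|Fmu].
  apply: cvg_trans (@initial_continuous (Delta ab) R (test_integral g) mu).
  by move=> A /= /(Fmu g).
apply/cvg_sup => g A; rewrite nbhsE => -[B [[C Cop <-] Cmu] BA].
by apply: filterS BA _; apply: Fmu; exact: open_nbhs_nbhs.
Qed.

Definition borelDelta := g_sigma_algebraType (@open (Delta ab)).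

HB.instance Definition _ := Measurable.on borelDelta.

End weak_convergence.

Section contest.
Context (R : realType) (a b : R) (ab : a <= b).
Implicit Types (k : R) (q : R -> Delta ab -> R) (pi : R -> R).

(* Only the values of q on [a, b] matter. *)
Definition allocation_rule k q :=
  [/\ forall x mu, x \in `[a, b] -> 0 <= q x mu <= 1,
      forall mu, {in `[a, b] &, {homo q ^~ mu : x y / x <= y}} &
      forall mu : Delta ab, (\int[mu]_(x in `[a, b]) (q x mu)%:E = k%:E)%E].

Definition interim_payoff pi q (mu : borelDelta ab) : \bar R :=
  (\int[mu : Delta ab]_(x in `[a, b]) (q x mu * pi x)%:E)%E.

Definition designer_payoff pi (M : probability (borelDelta ab) R) q : \bar R :=
  (\int[M]_mu interim_payoff pi q mu)%E.

(* The payoff of q is defined as soon as the interim payoff, which is bounded,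
   is Borel in mu; q ^~ mu is monotone, so no further measurability is needed. *)
Definition feasible k pi q :=
  allocation_rule k q /\
  measurable_fun [set: borelDelta ab] (interim_payoff pi q).

Definition optimal k pi M q :=
  feasible k pi q /\
  forall q', feasible k pi q' ->
    (designer_payoff pi M q' <= designer_payoff pi M q)%E.

Definition cutoff (t p x : R) : R :=
  if x < t then 0 else if x == t then p else 1.

(* The value p of the cutoff rule at its cutoff t is left free in [0, 1]. *)
Definition cutoff_solution k (mu : Delta ab) (t p : R) :=
  [/\ t \in `[a, b], p \in `[0, 1] &
      (\int[mu]_(x in `[a, b]) (cutoff t p x)%:E = k%:E)%E].

Definition two_step (x' x'' alpha x : R) : R :=
  if x < x' then 0 else if x <= x'' then alpha else 1.

(* Equality of two rules up to null sets of competitions and of efforts *)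
Definition ae_same_rule (M : probability (borelDelta ab) R) q1 q2 :=
  {ae M, forall mu : borelDelta ab,
    {ae (mu : Delta ab),
      forall x : measurableTypeR R, x \in `[a, b] -> q1 x mu = q2 x mu}}.

End contest.

(* Main.v *)
(* For a fixed competition mu everything is a linear programme over monotone
   rules. If pi is monotone, comparing pi with its value at the cutoff (resp. at
   the point where q crosses k) gives the optimum and its uniqueness. For
   general pi, let W m be the value of the cutoff rule of mass m: it is
   Lipschitz, so by the intermediate value theorem some multiplier l makes
   W m - l m reach its global maximum S both at a mass at least k and at a mass
   at most k. By the layer-cake formula S bounds the value of pi - l under every
   monotone rule, and mixing the two maximal upper sets so as to give mass k is
   optimal. Continuity of pi lets the larger upper set be taken closed and the
   smaller one open, which is the two-step form. Finally, the optimal interim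
   payoff is Borel in mu because, by an exact penalty, it is a supremum over
   continuous monotone g of the weakly continuous functions of mu
     int g pi dmu - C | int g dmu - k |. *)
Require Import Defs.
From HB Require Import structures.
From mathcomp Require Import all_boot all_order all_algebra.
From mathcomp Require Import all_classical all_reals all_analysis.
From mathcomp Require Import measurable_realfun.
From mathcomp Require Import ring lra.

Set Implicit Arguments.
Unset Strict Implicit.
Unset Printing Implicit Defensive.

Import Order.TTheory GRing.Theory Num.Theory.
Import numFieldNormedType.Exports.

Local Open Scope classical_set_scope.
Local Open Scope ring_scope.

(** * Bounded measurable functions *)

Definition bounded_measurable (R : realType) d (T : measurableType d)
    (D : set T) (f : T -> R) :=
  measurable_fun D f /\ exists C, forall x, D x -> `|f x| <= C.

Section bounded_measurable.
Context (R : realType) d (T : measurableType d) (D : set T).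
Implicit Types f g : T -> R.

Lemma bounded_measurable_cst (c : R) : bounded_measurable D (fun=> c).
Proof. by split; [exact: measurable_cst|exists `|c|]. Qed.

Lemma bounded_measurableD f g : bounded_measurable D f ->
  bounded_measurable D g -> bounded_measurable D (fun x => f x + g x).
Proof.
move=> [mf [C fC]] [mg [C' gC']]; split; first exact: measurable_funD.
exists (C + C') => x Dx.
by rewrite (le_trans (ler_normD _ _))// lerD ?fC ?gC'.
Qed.

Lemma bounded_measurableM f g : bounded_measurable D f ->
  bounded_measurable D g -> bounded_measurable D (fun x => f x * g x).
Proof.
move=> [mf [C fC]] [mg [C' gC']]; split; first exact: measurable_funM.
by exists (C * C') => x Dx; rewrite normrM ler_pM ?fC ?gC'.
Qed.

Lemma bounded_measurableB f g : bounded_measurable D f ->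
  bounded_measurable D g -> bounded_measurable D (fun x => f x - g x).
Proof.
move=> [mf [C fC]] [mg [C' gC']]; split; first exact: measurable_funB.
exists (C + C') => x Dx.
by rewrite (le_trans (ler_normB _ _))// lerD ?fC ?gC'.
Qed.

Lemma bounded_measurable_norm f : bounded_measurable D f ->
  bounded_measurable D (fun x => `|f x|).
Proof.
move=> [mf [C fC]]; split; first exact: measurableT_comp.
by exists C => x Dx; rewrite normr_id fC.
Qed.

Lemma bounded_measurable_sum (I : Type) (s : seq I) (f : I -> T -> R) :
  (forall i, bounded_measurable D (f i)) ->
  bounded_measurable D (fun x => \sum_(i <- s) f i x).
Proof.
move=> bf; elim: s => [|i s IHs].
  rewrite (_ : (fun x => _) = fun=> 0); last by apply/funext => x;
    rewrite big_nil.
  exact: bounded_measurable_cst.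
rewrite (_ : (fun x => _) = fun x => f i x + \sum_(j <- s) f j x).
  exact: bounded_measurableD.
by apply/funext => x; rewrite big_cons.
Qed.

End bounded_measurable.

(** * Integrals of bounded functions over a set of mass one *)

Section bounded_integral.
Context (R : realType) d (T : measurableType d).
Context (mu : {measure set T -> \bar R}) (D : set T).
Hypotheses (mD : measurable D) (muD : mu D = 1%E).
Implicit Types f g : T -> R.

Local Notation E f := (\int[mu]_(x in D) f x).
Local Notation bm := (bounded_measurable D).

Lemma bounded_integrable f : bm f -> mu.-integrable D (EFin \o f).
Proof.
move=> [mf [C fC]]; apply: measurable_bounded_integrable => //.
  by rewrite muD ltry.
exists C; split; first by rewrite num_real.
by move=> M CM x Dx; exact: le_trans (fC _ Dx) (ltW CM).
Qed.

Lemma bounded_integralE f : bm f -> (\int[mu]_(x in D) (f x)%:E = (E f)%:E)%E.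
Proof. by move=> bf; rewrite fineK//;
  exact/integrable_fin_num/bounded_integrable. Qed.

Lemma bounded_integral_cst (c : R) : E (fun=> c) = c.
Proof. by rewrite Rintegral_cst// muD mulr1. Qed.

Lemma bounded_integralD f g : bm f -> bm g ->
  E (fun x => f x + g x) = E f + E g.
Proof. by move=> bf bg; rewrite RintegralD//; exact: bounded_integrable. Qed.

Lemma bounded_integralB f g : bm f -> bm g ->
  E (fun x => f x - g x) = E f - E g.
Proof. by move=> bf bg; rewrite RintegralB//; exact: bounded_integrable. Qed.

Lemma bounded_integralZ c f : bm f -> E (fun x => c * f x) = c * E f.
Proof. by move=> bf; rewrite RintegralZl//; exact: bounded_integrable. Qed.

Lemma bounded_integral_sum (I : Type) (s : seq I) (f : I -> T -> R) :
  (forall i, bm (f i)) ->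
  E (fun x => \sum_(i <- s) f i x) = \sum_(i <- s) E (f i).
Proof.
move=> bf; elim: s => [|i s IHs].
  rewrite big_nil -[RHS](bounded_integral_cst 0).
  by apply: eq_Rintegral => x _; rewrite big_nil.
rewrite big_cons -IHs -bounded_integralD//; last exact: bounded_measurable_sum.
by apply: eq_Rintegral => x _; rewrite big_cons.
Qed.

Lemma bounded_integral_le f g : bm f -> bm g ->
  (forall x, D x -> f x <= g x) -> E f <= E g.
Proof. by move=> bf bg fg; rewrite le_Rintegral//;
  exact: bounded_integrable. Qed.

Lemma bounded_integral_norm f : bm f -> `|E f| <= E (fun x => `|f x|).
Proof. by move=> bf; apply: le_normr_Rintegral => //;
  exact: bounded_integrable. Qed.

Lemma bounded_integral_ae f g : bm f -> bm g ->
  {ae mu, forall x, D x -> f x = g x} -> E f = E g.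
Proof.
move=> [mf _] [mg _] fg; congr fine; apply: ae_eq_integral => //.
- exact/measurable_EFinP.
- exact/measurable_EFinP.
- by apply: filterS fg => x /= fg Dx; rewrite fg.
Qed.

Lemma bounded_integral_eq0 f : bm f -> (forall x, D x -> 0 <= f x) ->
  E f = 0 -> {ae mu, forall x, D x -> f x = 0}.
Proof.
move=> bf f0 Ef0.
have : ae_eq mu D (EFin \o f) (cst 0%E).
  apply/ae_eq_integral_abs => //; first by apply/measurable_EFinP; case: bf.
  rewrite -[RHS](congr1 EFin Ef0) -bounded_integralE//.
  by apply: eq_integral => x /set_mem Dx /=; rewrite ger0_norm ?f0.
by apply: filterS => x /= + Dx => /(_ Dx) [].
Qed.

Lemma bounded_integral_eq_le f g : bm f -> bm g ->
  (forall x, D x -> f x <= g x) -> E f = E g ->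
  {ae mu, forall x, D x -> f x = g x}.
Proof.
move=> bf bg fg Efg.
have /bounded_integral_eq0 : bm (fun x => g x - f x)
  by exact: bounded_measurableB.
rewrite bounded_integralB// Efg subrr => /(_ _ erefl) H.
have {H} : {ae mu, forall x, D x -> g x - f x = 0}.
  by apply: H => x Dx; rewrite subr_ge0 fg.
by apply: filterS => x /= + Dx => /(_ Dx) /eqP; rewrite subr_eq0 => /eqP.
Qed.

(** Dominated convergence: the constant [C] is integrable because [D] has mass one. *)
Lemma bounded_integral_cvg (f_ : nat -> T -> R) f (C : R) :
  (forall n, measurable_fun D (f_ n)) -> bm f ->
  (forall n x, D x -> `|f_ n x| <= C) ->
  (forall x, D x -> f_ ^~ x @ \oo --> f x) ->
  (fun n => E (f_ n)) @ \oo --> E f.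
Proof.
move=> mf_ bf fC f_f; apply: fine_cvg; rewrite -bounded_integralE//.
have [||||| _ _ +] := @dominated_convergence _ T R mu D mD
  (fun n x => (f_ n x)%:E) (fun x => (f x)%:E) (fun=> C%:E).
- by move=> n; exact/measurable_EFinP.
- by apply/measurable_EFinP; case: bf.
- by apply: aeW => x Dx; apply: cvg_EFin; [exact: nearW|exact: f_f].
- exact: bounded_integrable (bounded_measurable_cst _ _).
- by apply: aeW => x n Dx; rewrite lee_fin fC.
- exact.
Qed.

End bounded_integral.

(** * Cutoff functions: order, mixtures and limits *)

Section cutoff_rules.
Context (R : realType).
Implicit Types t p x : R.

Lemma zero_in01 : 0 <= (0 : R) <= 1.
Proof. by rewrite lexx ler01. Qed.

Lemma one_in01 : 0 <= (1 : R) <= 1.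
Proof. by rewrite lexx ler01. Qed.

Lemma cutoff_itv t p x : 0 <= p <= 1 -> 0 <= cutoff t p x <= 1.
Proof. by rewrite /cutoff; case: ltgtP => // *; rewrite ?lexx ?ler01. Qed.

Lemma cutoff_homo t p : 0 <= p <= 1 -> {homo cutoff t p : x y / x <= y}.
Proof.
move=> /andP[p0 p1] x y xy; rewrite /cutoff.
case: (ltgtP x t) => [xt|tx|xt]; case: (ltgtP y t) => [yt|ty|yt] //.
- by rewrite leNgt (lt_trans yt tx) in xy.
- by rewrite leNgt yt tx in xy.
- by rewrite leNgt xt yt in xy.
Qed.

(** [cutoff t 0] and [cutoff t 1] are the indicators of the open and of the closed half-line at [t];
    [p] interpolates between them. *)
Lemma cutoff_convex t p x :
  cutoff t p x = cutoff t 0 x + p * (cutoff t 1 x - cutoff t 0 x).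
Proof. by rewrite /cutoff; case: ltgtP => // _; ring. Qed.

Lemma cutoff_le t p t' p' : 0 <= p <= 1 -> 0 <= p' <= 1 ->
  t < t' \/ t = t' /\ p' <= p -> forall x, cutoff t' p' x <= cutoff t p x.
Proof.
move=> /andP[p0 p1] /andP[p0' p1'] tt' x; rewrite /cutoff.
case: tt' => [tt'|[<- pp']]; last by case: ltgtP.
case: (ltgtP x t') => [xt|tx|xt].
- by case: ltgtP.
- by rewrite ltNge (ltW (lt_trans tt' tx)) gt_eqF ?(lt_trans tt' tx).
- by rewrite ltNge xt (ltW tt')/= gt_eqF.
Qed.

(** Lexicographic comparison: a smaller threshold, or a larger value at the same threshold, gives
    the larger function. *)
Lemma cutoff_total t p t' p' : 0 <= p <= 1 -> 0 <= p' <= 1 ->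
  (forall x, cutoff t p x <= cutoff t' p' x) \/
  (forall x, cutoff t' p' x <= cutoff t p x).
Proof.
move=> p01 p01'; case: (ltgtP t t') => tt'.
- by right; apply: cutoff_le => //; left.
- by left; apply: cutoff_le => //; left.
- case: (leP p p') => pp'; first by left; apply: cutoff_le => //; right.
  by right; apply: cutoff_le => //; right; rewrite tt' ltW.
Qed.

(** The closed half-line at [x'] is mixed with the open one at [x'']; the optimum is built in this
    form. *)
Lemma two_stepE x' x'' p x : x' <= x'' ->
  two_step x' x'' p x = cutoff x'' 0 x + p * (cutoff x' 1 x - cutoff x'' 0 x).
Proof.
move=> xx; rewrite /two_step /cutoff.
case: (ltgtP x x') => [xx'|x'x|xx'];
  case: (ltgtP x x'') => [xx''|x''x|xx''] //=;
  try ring; move: xx; rewrite leNgt => /negP[].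
  1: exact: lt_trans x''x xx'.
all: by rewrite -?xx' -?xx''.
Qed.

Lemma two_step_cutoff t p : two_step t t p = cutoff t p.
Proof. by apply/funext => x; rewrite /two_step /cutoff; case: ltgtP. Qed.

Lemma convex_comb_between (u v m : R) : u <= m <= v ->
  exists2 p, 0 <= p <= 1 & m = u + p * (v - u).
Proof.
move=> /andP[um mv]; have [uv|uv] := eqVneq u v.
  by exists 0; rewrite ?lexx ?ler01// mul0r addr0; apply/eqP;
    rewrite eq_le um uv mv.
have uv0 : 0 < v - u by rewrite subr_gt0 lt_neqAle uv (le_trans um).
exists ((m - u) / (v - u)); last by rewrite divfK ?gt_eqF// addrC subrK.
by rewrite divr_ge0 ?subr_ge0 ?(le_trans um)//= ler_pdivrMr// mul1r lerB.
Qed.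

Lemma near_natSinv_lt (e : R) : 0 < e -> \forall n \near \oo, n.+1%:R^-1 < e.
Proof. by move=> e0; exact: (near_infty_natSinv_lt (PosNum e0)). Qed.

(** The open half-lines at [t + 1/(n+1)] increase to the open half-line at [t]. *)
Lemma cutoff_cvg_right t x :
  (fun n => cutoff (t + n.+1%:R^-1) 0 x) @ \oo --> cutoff t 0 x.
Proof.
apply: cvg_near_cst; case: (ltgtP x t) => [xt|tx|->].
- by apply: nearW => n; rewrite /cutoff xt ltr_wpDr.
- near=> n; have tnx : t + n.+1%:R^-1 < x.
    by rewrite -ltrBrDl; near: n; apply: near_natSinv_lt; rewrite subr_gt0.
  by rewrite /cutoff ![_ < _]ltNge !ltW//= !gt_eqF.
- by apply: nearW => n; rewrite /cutoff ltxx eqxx ltrDl invr_gt0 ltr0n.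
Unshelve. all: by end_near. Qed.

(** From the left the half-lines decrease to the closed one, hence the value 1 at [t] in the
    limit. *)
Lemma cutoff_cvg_left t x :
  (fun n => cutoff (t - n.+1%:R^-1) 0 x) @ \oo --> cutoff t 1 x.
Proof.
apply: cvg_near_cst; case: (ltgtP x t) => [xt|tx|->].
- near=> n; have tnx : x < t - n.+1%:R^-1.
    by rewrite ltrBrDl -ltrBrDr; near: n; apply: near_natSinv_lt;
      rewrite subr_gt0.
  by rewrite /cutoff xt tnx.
- apply: nearW => n; have tnx : t - n.+1%:R^-1 < x.
    by rewrite (le_lt_trans _ tx)// gerBl invr_ge0.
  by rewrite /cutoff ![_ < _]ltNge !ltW//= !gt_eqF.
- apply: nearW => n; have tnx : t - n.+1%:R^-1 < t.
    by rewrite gtrBl invr_gt0 ltr0n.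
  by rewrite /cutoff ltxx eqxx ltNge ltW//= gt_eqF.
Unshelve. all: by end_near. Qed.

End cutoff_rules.
Arguments zero_in01 {R}.
Arguments one_in01 {R}.

(** * Monotone rules, and cutoff rules of prescribed mass *)

Section monotone_rules.
Context (R : realType) (a b : R) (ab : a <= b).
Implicit Types (mu : Delta ab) (f q : R -> R).

Local Notation I := (`[a, b]%classic : set (measurableTypeR R)).
Local Notation bm := (@bounded_measurable R _ (measurableTypeR R) I).
Local Notation E mu f := (\int[mu : Delta ab]_(x in I) f x).

(** An allocation rule at one fixed competition, with the mass constraint left out. *)
Definition monotone_rule q :=
  (forall x, I x -> 0 <= q x <= 1) /\ {in `[a, b] &, {homo q : x y / x <= y}}.

Lemma measurable_segment : measurable I.
Proof. exact: measurable_itv. Qed.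

(** Preimages of closed upper half-lines are intervals, hence Borel. *)
Lemma monotone_rule_bounded_measurable q : monotone_rule q -> bm q.
Proof.
move=> [q01 qh]; split; last first.
  by exists 1 => x /q01 /andP[q0 q1]; rewrite ger0_norm.
apply: (measurability (@RGenCInfty.G R)) => [|/= _ [_] [r] -> <-].
  exact: RGenCInfty.measurableE.
apply: is_interval_measurable => s t /= [Is rs] [It rt] u /andP[su ut].
have Iu : u \in `[a, b].
  by move: Is It; rewrite !in_itv/= => /andP[as_ _] /andP[_ tb];
    rewrite (le_trans as_)// (le_trans ut).
split=> //; move: rs; rewrite /= !in_itv/= !andbT => rs.
by rewrite (le_trans rs)// qh.
Qed.

Lemma continuous_bounded_measurable f : {within `[a, b], continuous f} -> bm f.
Proof.
move=> cf; split.
  exact: subspace_continuous_measurable_fun measurable_segment cf.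
have [c _ fc] := EVT_max ab cf; have [c' _ fc'] := EVT_min ab cf.
exists (Num.max `|f c| `|f c'|) => x Ix; rewrite le_max.
have [fx0|fx0] := leP 0 (f x); apply/orP; [left|right].
  by rewrite ger0_norm// (le_trans (fc _ Ix))// ler_norm.
by rewrite ltr0_norm// -normrN (le_trans _ (ler_norm _))// lerN2 fc'.
Qed.

Lemma cutoff_monotone_rule t p : 0 <= p <= 1 -> monotone_rule (cutoff t p).
Proof.
move=> p01; split; first by move=> x _; exact: cutoff_itv.
by move=> x y _ _; exact: cutoff_homo.
Qed.

Lemma cutoff_bounded_measurable t p : 0 <= p <= 1 -> bm (cutoff t p).
Proof.
by move=> /(cutoff_monotone_rule t)/monotone_rule_bounded_measurable.
Qed.

(** The mass beyond [t] is non-increasing in [t]. At the first point where it is at most [m], the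
    limits from the right and from the left enclose [m] between the masses of the open and of the
    closed half-line, and [p] interpolates. *)
Lemma cutoff_exists mu (m : R) : 0 <= m <= 1 ->
  exists t p, [/\ I t, 0 <= p <= 1 & E mu (cutoff t p) = m].
Proof.
move=> /andP[m0 m1].
have mI := measurable_segment; have muI := Delta_mass mu.
have bc t p : 0 <= p <= 1 -> bm (cutoff t p)
  by exact: cutoff_bounded_measurable.
have bc0 t : bm (cutoff t 0) by apply: bc; rewrite zero_in01.
have bc1 t : bm (cutoff t 1) by apply: bc; rewrite one_in01.
have cle u v : u < v -> E mu (cutoff v 0) <= E mu (cutoff u 0).
  move=> uv; apply: bounded_integral_le => // x _.
  by apply: cutoff_le; rewrite ?zero_in01//; left.
pose A := [set x | I x /\ E mu (cutoff x 0) <= m].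
have Ab : A b.
  split; first by rewrite /= in_itv/= ab lexx.
  suff -> : E mu (cutoff b 0) = 0 by [].
  rewrite -[RHS](bounded_integral_cst mI muI 0).
  apply: eq_Rintegral => x; rewrite inE /= in_itv/= => /andP[_].
  by rewrite /cutoff; case: ltgtP.
have Ainf : has_inf A.
  by split; [exists b|exists a => x [/=]; rewrite in_itv/= => /andP[]].
pose t := inf A.
have It : I t.
  rewrite /= in_itv/=; apply/andP; split; last by apply: ge_inf => //;
    case: Ainf.
  by apply: lb_le_inf; [exists b|move=> x [/=]; rewrite in_itv/= => /andP[]].
have t0 : E mu (cutoff t 0) <= m.
  apply: (@cvgr_to_le _ \oo _ _ (fun n => E mu (cutoff (t + n.+1%:R^-1) 0))).
    apply: (@bounded_integral_cvg _ _ _ _ _ mI muI _ _ 1) => // [n|n x _|x _].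
    - by case: (bc0 (t + n.+1%:R^-1)).
    - have /andP[c0 c1] := cutoff_itv (t + n.+1%:R^-1) x zero_in01.
      by rewrite ger0_norm.
    - exact: cutoff_cvg_right.
  apply: nearW => n.
    have [|x [Ix xm] xt] := @inf_adherent _ A n.+1%:R^-1 _ Ainf.
      by rewrite invr_gt0.
    exact: le_trans (cle _ _ xt) xm.
have t1 : m <= E mu (cutoff t 1).
  apply: (@cvgr_to_ge _ \oo _ _ (fun n => E mu (cutoff (t - n.+1%:R^-1) 0))).
    apply: (@bounded_integral_cvg _ _ _ _ _ mI muI _ _ 1) => // [n|n x _|x _].
    - by case: (bc0 (t - n.+1%:R^-1)).
    - have /andP[c0 c1] := cutoff_itv (t - n.+1%:R^-1) x zero_in01.
      by rewrite ger0_norm.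
    - exact: cutoff_cvg_left.
  apply: nearW => n; set s := t - _.
    have st : s < t by rewrite gtrBl invr_gt0.
    (* Below [a] the half-line covers the whole segment and has mass one; otherwise [s] is in the
       segment but below the infimum of [A], so its mass exceeds [m]. *)
    have [sa|sa] := ltP s a.
      suff -> : E mu (cutoff s 0) = 1 by [].
      rewrite -[RHS](bounded_integral_cst mI muI 1).
      apply: eq_Rintegral => x; rewrite inE /= in_itv/= => /andP[ax _].
      have sx : s < x by exact: lt_le_trans ax.
      by rewrite /cutoff ltNge ltW//= gt_eqF.
    rewrite leNgt; apply/negP => sm.
    have : t <= s; last by rewrite leNgt st.
    apply: ge_inf; first by case: Ainf.
    split; last exact: ltW.
    rewrite /= in_itv/= sa (le_trans (ltW st))//.
    by move: It; rewrite /= in_itv/= => /andP[].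
have [|p p01 mp] :=
  @convex_comb_between R (E mu (cutoff t 0)) (E mu (cutoff t 1)) m.
  by rewrite t0.
exists t, p; split => //; rewrite mp.
rewrite -bounded_integralB// -bounded_integralZ//;
  last exact: bounded_measurableB.
rewrite -bounded_integralD//; last first.
  by apply: bounded_measurableM; [exact: bounded_measurable_cst|exact:
    bounded_measurableB].
by apply: eq_Rintegral => x _; exact: cutoff_convex.
Qed.

End monotone_rules.

(** * Two facts on continuity within a segment *)

Section calculus.
Context (R : realType).

Lemma lipschitz_within_continuous (f : R -> R) (u v C : R) :
  {in `[u, v] &, forall x y, `|f x - f y| <= C * `|x - y|} ->
  {within `[u, v], continuous f}.
Proof.
move=> fC; apply/subspace_continuousP => x Ix; apply/cvgrPdist_lt => e e0.
(* [|C| + 1] dominates [C] and is positive, so that [e] can be divided by it. *)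
have C1 : 0 < `|C| + 1 by rewrite ltr_pwDr.
rewrite near_withinE; near=> y => Iy.
rewrite (le_lt_trans (fC _ _ Ix Iy))//.
rewrite (@le_lt_trans _ _ ((`|C| + 1) * `|x - y|))//.
  by rewrite ler_wpM2r// (le_trans (ler_norm C))// lerDl.
rewrite mulrC -ltr_pdivlMr//; near: y.
by apply: (@cvgr_dist_lt _ R^o); [exact: cvg_id|rewrite divr_gt0].
Unshelve. all: by end_near. Qed.

(** Persistence of sign: it leaves room to move a cutoff away from a point of negative value. *)
Lemma within_continuous_lt0 (f : R -> R) (u v t : R) :
  {within `[u, v], continuous f} -> t \in `[u, v] -> f t < 0 ->
  exists2 e, 0 < e & forall x, x \in `[u, v] -> `|t - x| < e -> f x < 0.
Proof.
move=> /subspace_continuousP cf It ft0.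
have := @cvgr_lt _ _ _ _ _ _ (cf t It) 0 ft0.
rewrite near_withinE -nbhs_ballE => -[e /= e0 H].
by exists e => // x Ix tx; exact: H.
Qed.

End calculus.

(** * Comparing the values of two rules *)

Section comparisons.
Context (R : realType) d (T : measurableType d).
Context (mu : {measure set T -> \bar R}) (D : set T).
Hypotheses (mD : measurable D) (muD : mu D = 1%E).
Implicit Types f q : T -> R.

Local Notation E f := (\int[mu]_(x in D) f x).
Local Notation bm := (bounded_measurable D).

(** [l] is a price on mass: among rules of equal mass it shifts every value by the same amount. *)
Lemma integral_lagrangian q f (l : R) : bm q -> bm f ->
  E (fun x => q x * (f x - l)) = E (fun x => q x * f x) - l * E q.
Proof.
move=> bq bf; rewrite -bounded_integralZ// -bounded_integralB//.
- by apply: eq_Rintegral => x _; ring.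
- exact: bounded_measurableM.
- by apply: bounded_measurableM => //; exact: bounded_measurable_cst.
Qed.

Lemma integral_diffM q1 q2 f : bm q1 -> bm q2 -> bm f ->
  E (fun x => (q1 x - q2 x) * f x) =
  E (fun x => q1 x * f x) - E (fun x => q2 x * f x).
Proof.
move=> b1 b2 bf; rewrite -bounded_integralB//; do ?exact: bounded_measurableM.
by apply: eq_Rintegral => x _; ring.
Qed.

(** Single crossing: [q1] lies above [q2] only where [f] is nonnegative, and below it only where [f]
    is nonpositive. *)
Lemma integral_crossing_le q1 q2 f : bm q1 -> bm q2 -> bm f ->
  (forall x, D x -> 0 <= (q1 x - q2 x) * f x) ->
  E (fun x => q2 x * f x) <= E (fun x => q1 x * f x).
Proof.
move=> b1 b2 bf q12; rewrite -subr_ge0 -integral_diffM//.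
exact: Rintegral_ge0.
Qed.

(** The integrand [(q1 - q2) f] is nonnegative with integral at most zero. *)
Lemma integral_crossing_eq q1 q2 f : bm q1 -> bm q2 -> bm f ->
  (forall x, D x -> 0 <= (q1 x - q2 x) * f x) ->
  E (fun x => q1 x * f x) <= E (fun x => q2 x * f x) ->
  {ae mu, forall x, D x -> (q1 x - q2 x) * f x = 0}.
Proof.
move=> b1 b2 bf q12 E12; apply: bounded_integral_eq0 => //.
  by apply: bounded_measurableM => //; exact: bounded_measurableB.
apply/eqP; rewrite eq_le Rintegral_ge0// andbT.
by rewrite integral_diffM// subr_le0.
Qed.

Lemma integral_crossing_strict q1 q2 f : bm q1 -> bm q2 -> bm f ->
  (forall x, D x -> 0 <= (q1 x - q2 x) * f x) ->
  (forall x, D x -> q1 x <> q2 x -> f x != 0) ->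
  E (fun x => q1 x * f x) <= E (fun x => q2 x * f x) ->
  {ae mu, forall x, D x -> q1 x = q2 x}.
Proof.
move=> b1 b2 bf q12 q0 /(integral_crossing_eq b1 b2 bf q12).
apply: filterS => x H Dx; have [//|/eqP q12x] := eqVneq (q1 x) (q2 x).
move/eqP : (H Dx); rewrite mulf_eq0 (negbTE (q0 _ Dx q12x)) orbF subr_eq0.
by move/eqP.
Qed.

(** For ordered rules the L1 distance is the difference of the masses. *)
Lemma integral_ordered_lipschitz q1 q2 f (C : R) : bm q1 -> bm q2 -> bm f ->
  (forall x, D x -> q1 x <= q2 x) -> (forall x, D x -> `|f x| <= C) ->
  `|E (fun x => q1 x * f x) - E (fun x => q2 x * f x)| <= C * (E q2 - E q1).
Proof.
move=> b1 b2 bf q12 fC.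
have b21 : bm (fun x => q2 x - q1 x) by exact: bounded_measurableB.
have bd : bm (fun x => (q2 x - q1 x) * f x) by exact: bounded_measurableM.
rewrite distrC -integral_diffM// (le_trans (bounded_integral_norm _ _ _))//.
rewrite -bounded_integralB// -bounded_integralZ//.
apply: bounded_integral_le => //; first exact: bounded_measurable_norm.
  by apply: bounded_measurableM => //; exact: bounded_measurable_cst.
move=> x Dx; rewrite normrM mulrC [`|q2 x - q1 x|]ger0_norm ?subr_ge0 ?q12//.
by rewrite ler_wpM2r ?subr_ge0 ?q12 ?fC.
Qed.

(* Off [c] the rules agree almost everywhere, so their difference is a.e. a
   multiple of the indicator of [c], with zero integral. *)
Lemma integral_eq_off_point q1 q2 (c : T) : bm q1 -> bm q2 -> E q1 = E q2 ->
  {ae mu, forall x, D x -> x <> c -> q1 x = q2 x} ->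
  {ae mu, forall x, D x -> q1 x = q2 x}.
Proof.
(* Multiplying the difference by its own value [e] at [c] makes it a square there, so the product is
   nonnegative almost everywhere whatever the sign of [e]. *)
move=> b1 b2 E12 H; set e := q1 c - q2 c.
have bq : bm (fun x => q1 x - q2 x) by exact: bounded_measurableB.
have be : bm (fun x => e * (q1 x - q2 x)).
  by apply: bounded_measurableM => //; exact: bounded_measurable_cst.
have ben := bounded_measurable_norm be.
have En : E (fun x => `|e * (q1 x - q2 x)|) = 0.
  rewrite (@bounded_integral_ae _ _ _ mu D mD _ (fun x => e * (q1 x - q2 x)))//.
    by rewrite bounded_integralZ// bounded_integralB// E12 subrr mulr0.
  apply: filterS H => x qx Dx; have [->|/eqP xc] := eqVneq x c.
    by rewrite -/e ger0_norm// -expr2 sqr_ge0.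
  by rewrite (qx Dx xc) subrr mulr0 normr0.
have := bounded_integral_eq0 mD muD ben (fun x _ => normr_ge0 _) En.
apply: filterS2 H => x qx + Dx => /(_ Dx)/normr0_eq0.
have [-> /eqP|/eqP xc _] := eqVneq x c; last exact: qx.
by rewrite -/e mulf_eq0 orbb subr_eq0 => /eqP.
Qed.

End comparisons.

(** * Layer-cake bound for monotone rules *)

Section layer_cake.
Context (R : realType) (a b : R) (ab : a <= b).
Implicit Types (mu : Delta ab) (f q : R -> R).

Local Notation I := (`[a, b]%classic : set (measurableTypeR R)).
Local Notation bm := (@bounded_measurable R _ (measurableTypeR R) I).
Local Notation E mu f := (\int[mu : Delta ab]_(x in I) f x).
Let mI : measurable I := measurable_segment a b.

(** The level set is an upper set of the segment, that is, a half-line starting at its infimum; the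
    value at the cutoff records whether the infimum belongs to it. *)
Lemma level_set_cutoff q (s : R) : monotone_rule a b q ->
  exists t p, [/\ I t, 0 <= p <= 1 &
    forall x, I x -> (s <= q x)%R%:R = cutoff t p x].
Proof.
move=> [_ qh]; pose A := [set x | I x /\ s <= q x].
have [[y Ay]|A0] := pselect (A !=set0); last first.
  (* For an empty level set: this cutoff function vanishes on the whole segment. *)
  exists b, 0; rewrite zero_in01; split => //;
    first by rewrite /= in_itv/= ab lexx.
  move=> x Ix; have : ~~ (s <= q x) by apply/negP => sq; apply: A0; exists x.
  move/negbTE => ->; move: Ix; rewrite /= in_itv/= /cutoff => /andP[_].
  by case: ltgtP.
have Ainf : has_inf A.
  by split; [exists y|exists a => x [/=]; rewrite in_itv/= => /andP[]].
pose t := inf A; have tA x : A x -> t <= x by apply: ge_inf; case: Ainf.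
have It : I t.
  case: (Ay) => /=; rewrite !in_itv/= => /andP[_ yb] _; apply/andP; split.
    by apply: lb_le_inf; [exists y|move=> x [/=]; rewrite in_itv/= => /andP[]].
  exact: le_trans (tA _ Ay) yb.
exists t, (s <= q t)%R%:R; split => //; first by case: (s <= q t);
  rewrite ?lexx ?ler01.
move=> x Ix; rewrite /cutoff; case: ltgtP => [xt|tx|->//].
- case: (leP s (q x)) => // sq; have := tA x (conj Ix sq).
  by rewrite leNgt xt.
- have [|z [Iz sz] zx] := @inf_adherent _ A (x - t) _ Ainf.
    by rewrite subr_gt0.
  by rewrite (le_trans sz)// qh// ltW// (lt_le_trans zx)// -/t addrC subrK.
Qed.

(** The sum counts the integers from 1 to [n] that are at most [y], so it is the integer part of
    [y]. *)
Lemma sum_le_truncn (y : R) n : 0 <= y <= n%:R ->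
  `|y - \sum_(i < n) (i.+1%:R <= y)%R%:R| <= 1.
Proof.
move=> /andP[y0 yn].
have -> : \sum_(i < n) (i.+1%:R <= y)%R%:R = (Num.truncn y)%:R :> R.
  have -> : \sum_(i < n) (i.+1%:R <= y)%R%:R =
      (\sum_(i < n) (i < Num.truncn y))%:R :> R.
    rewrite natr_sum; apply: eq_bigr => i _.
    by rewrite truncn_ge_nat.
  congr (_%:R); have : (Num.truncn y <= n)%N.
    by rewrite -(ler_nat R) (le_trans _ yn)// truncn_le.
  elim: n {yn} (Num.truncn y) => [m|n IHn m].
    by rewrite leqn0 big_ord0 => /eqP ->.
  case: m => [_|m mn]; first by rewrite big1.
  by rewrite big_ord_recl (eq_bigr (fun i : 'I_n => (i < m)%N : nat)) ?IHn.
have /andP[ty yt] := truncn_itv y0.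
rewrite ger0_norm ?subr_ge0//.
by rewrite lerBlDr (le_trans (ltW yt))// -natr1 addrC.
Qed.

(* [q] is within [1/n] of an average of indicators of upper level sets. *)
Lemma layer_cake_le mu f q (S : R) : bm f -> monotone_rule a b q ->
  (forall t p, I t -> 0 <= p <= 1 ->
    E mu (fun x => cutoff t p x * f x) <= S) ->
  E mu (fun x => q x * f x) <= S.
Proof.
move=> bf mq cS; have bq := monotone_rule_bounded_measurable mq.
have muI := Delta_mass mu; case: (bf) => _ [C fC].
apply/ler_addgt0Pr => e e0.
(* An error of [1/n] in the rule costs at most [C/n] in value. *)
have [n n0 nC] : exists2 n, (0 < n)%N & C / n%:R <= e.
  exists (Num.truncn (`|C| / e)).+1 => //;
    rewrite ler_pdivrMr// mulrC -ler_pdivrMr//.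
  apply: (@le_trans _ _ (`|C| / e)); last exact/ltW/truncnS_gt.
  by rewrite ler_pM2r ?invr_gt0// ler_norm.
have n0' : 0 < n%:R :> R by rewrite ltr0n.
(* The levels are [1/n, ..., n/n]; the shift [i.+1] skips level 0, which is always reached. *)
pose h (i : 'I_n) x : R := (i.+1%:R / n%:R <= q x)%R%:R.
have hcut i : exists t p, [/\ I t, 0 <= p <= 1 &
    forall x, I x -> h i x = cutoff t p x] by exact: level_set_cutoff.
have bh i : bm (h i).
  have [t [p [It p01 hE]]] := hcut i.
  have [mc [K cK]] := cutoff_bounded_measurable a b t p01.
  split; last by exists K => x Ix; rewrite hE// cK.
  by apply: eq_measurable_fun mc => x; rewrite inE => /hE.
have bhf i : bm (fun x => h i x * f x) by exact: bounded_measurableM.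
have hS i : E mu (fun x => h i x * f x) <= S.
  have [t [p [It p01 hE]]] := hcut i; rewrite (le_trans _ (cS t p It p01))//.
  rewrite le_eqVlt; apply/orP; left; apply/eqP.
  by apply: eq_Rintegral => x; rewrite inE => /hE ->.
pose r x := n%:R^-1 * \sum_(i < n) h i x.
have br : bm r.
  apply: bounded_measurableM; first exact: bounded_measurable_cst.
  exact: bounded_measurable_sum.
have qr x : I x -> `|q x - r x| <= n%:R^-1.
  move=> Ix; have -> : q x - r x =
      n%:R^-1 * (n%:R * q x - \sum_(i < n) (i.+1%:R <= n%:R * q x)%R%:R).
    rewrite mulrBr mulKf ?gt_eqF// /r; congr (_ - _ * _).
    by apply: eq_bigr => i _; rewrite /h ler_pdivrMr// mulrC.
  rewrite normrM ger0_norm ?invr_ge0// ler_piMr ?invr_ge0// sum_le_truncn//.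
  case: mq => q01 _; have /andP[q0 q1] := q01 _ Ix.
  by rewrite mulr_ge0//= ler_piMr.
have rS : E mu (fun x => r x * f x) <= S.
  have -> : E mu (fun x => r x * f x) =
      n%:R^-1 * \sum_(i < n) E mu (fun x => h i x * f x).
    rewrite -bounded_integral_sum// -bounded_integralZ//;
      last exact: bounded_measurable_sum.
    by apply: eq_Rintegral => x _; rewrite /r -mulrA mulr_suml.
  rewrite ler_pdivrMl//; apply: (@le_trans _ _ (\sum_(i < n) S)).
    exact: ler_sum.
  by rewrite sumr_const card_ord mulr_natl.
have -> : E mu (fun x => q x * f x) =
    E mu (fun x => r x * f x) + E mu (fun x => (q x - r x) * f x).
  by rewrite integral_diffM// addrC subrK.
rewrite lerD// (le_trans (ler_norm _))//.
have bqr : bm (fun x => (q x - r x) * f x).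
  by apply: bounded_measurableM => //; exact: bounded_measurableB.
rewrite (le_trans (bounded_integral_norm mI muI bqr))// (le_trans _ nC)//.
rewrite -(bounded_integral_cst mI muI (C / n%:R)).
apply: bounded_integral_le => //; first exact: bounded_measurable_norm.
  exact: bounded_measurable_cst.
by move=> x Ix; rewrite normrM mulrC ler_pM ?fC ?qr.
Qed.

End layer_cake.

(** * The optimum at a fixed competition *)

Section pointwise_optimum.
Context (R : realType) (a b : R) (ab : a <= b).
Implicit Types (mu : Delta ab) (f q : R -> R).

Local Notation I := (`[a, b]%classic : set (measurableTypeR R)).
Local Notation bm := (@bounded_measurable R _ (measurableTypeR R) I).
Local Notation E mu f := (\int[mu : Delta ab]_(x in I) f x).
Let mI : measurable I := measurable_segment a b.

(** Any two cutoff rules are ordered, so the bound for ordered rules applies. *)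
Lemma cutoff_lipschitz mu f (C : R) t p t' p' : bm f ->
  (forall x, I x -> `|f x| <= C) -> 0 <= p <= 1 -> 0 <= p' <= 1 ->
  `|E mu (fun x => cutoff t p x * f x) - E mu (fun x => cutoff t' p' x * f x)|
    <= C * `|E mu (cutoff t p) - E mu (cutoff t' p')|.
Proof.
move=> bf fC; have muI := Delta_mass mu.
wlog cc : t p t' p' / forall x, cutoff t p x <= cutoff t' p' x.
  move=> H p01 p01'; have [cc|cc] := cutoff_total t t' p01 p01'; first exact: H.
  by rewrite distrC (distrC (E mu (cutoff t p))); exact: H.
move=> p01 p01'; have bc := cutoff_bounded_measurable a b t p01.
have bc' := cutoff_bounded_measurable a b t' p01'.
rewrite (distrC (E mu (cutoff t p))) (@ger0_norm _ (E mu (cutoff t' p') - _)).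
  by apply: integral_ordered_lipschitz.
by rewrite subr_ge0 bounded_integral_le.
Qed.

(* The value [W m] of the cutoff rule of mass [m] is Lipschitz in [m]; the
   multiplier balances the maxima of [W m - l m] on both sides of [k]. *)
Lemma lagrange_multiplier mu f (k : R) : bm f -> 0 <= k <= 1 ->
  exists l S, let value t p := E mu (fun x => cutoff t p x * (f x - l)) in
  [/\ forall t p, I t -> 0 <= p <= 1 -> value t p <= S,
      exists t p,
        [/\ I t, 0 <= p <= 1, k <= E mu (cutoff t p) & value t p = S] &
      exists t p,
        [/\ I t, 0 <= p <= 1, E mu (cutoff t p) <= k & value t p = S]].
Proof.
move=> bf /andP[k0 k1]; have muI := Delta_mass mu.
have [C fC] : exists C, forall x, I x -> `|f x| <= C by case: bf.
have C0 : 0 <= C by rewrite (le_trans (normr_ge0 (f a)))// fC//= in_itv/= lexx.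
(* One cutoff rule is selected for each mass in [[0, 1]]; [(0, 0)] is a default for other [m]. *)
have /choice [tp tpP] : forall m, exists tp : R * R, 0 <= m <= 1 ->
    [/\ I tp.1, 0 <= tp.2 <= 1 & E mu (cutoff tp.1 tp.2) = m].
  move=> m; have [/(cutoff_exists mu) [t [p H]]|m01] := boolP (0 <= m <= 1).
    by exists (t, p).
  by exists (0, 0) => m01'; move: m01; rewrite m01'.
pose W m := E mu (fun x => cutoff (tp m).1 (tp m).2 x * f x).
have Wlip m m' : 0 <= m <= 1 -> 0 <= m' <= 1 -> `|W m - W m'| <= C * `|m - m'|.
  move=> /tpP[_ p01 mE] /tpP[_ p01' mE'].
  by rewrite -[in leRHS]mE -[in leRHS]mE'; exact: cutoff_lipschitz.
(* The value depends on the mass alone: by the Lipschitz bound, cutoff rules of equal mass have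
   equal value. *)
have WE t p : 0 <= p <= 1 ->
    E mu (fun x => cutoff t p x * f x) = W (E mu (cutoff t p)).
  move=> p01; have bc := cutoff_bounded_measurable a b t p01.
  have /tpP[_ p01' mE] : 0 <= E mu (cutoff t p) <= 1.
    rewrite Rintegral_ge0 ?andTb//=; last first.
      by move=> x _; case/andP: (cutoff_itv t x p01).
    rewrite -[leRHS](bounded_integral_cst mI muI);
      apply: bounded_integral_le => //.
      exact: bounded_measurable_cst.
    by move=> x _; case/andP: (cutoff_itv t x p01).
  apply/eqP; rewrite -subr_eq0 -normr_le0.
  by rewrite (le_trans (cutoff_lipschitz _ _ _ _ fC _ _))// mE subrr normr0
    mulr0.
have Wmax u v l : 0 <= u -> u <= v -> v <= 1 -> exists m, m \in `[u, v] /\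
    forall m', m' \in `[u, v] -> W m' - l * m' <= W m - l * m.
  move=> u0 uv v1.
  have sub x : x \in `[u, v] -> 0 <= x <= 1.
    by rewrite in_itv/= => /andP[ux xv]; rewrite (le_trans u0)//= (le_trans xv).
  have [|m mI' mM] := @EVT_max R (fun m => W m - l * m) u v uv;
    last by exists m.
  apply: (@lipschitz_within_continuous _ _ _ _ (C + `|l|)) => x y xI yI.
  have -> : W x - l * x - (W y - l * y) = (W x - W y) - l * (x - y) by ring.
  rewrite (le_trans (ler_normB _ _))// mulrDl lerD ?normrM//.
  by apply: Wlip; exact: sub.
have /choice [mA mAP] := fun l => Wmax k 1 l k0 k1 (lexx _).
have /choice [mB mBP] := fun l => Wmax 0 k l (lexx _) k0 k1.
(* A maximum over [m] of the functions [W m - l m], each 1-Lipschitz in [l] because [m] is in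
   [[0, 1]], is 1-Lipschitz in [l]. *)
have maxlip (u v : R) (m : R -> R) : 0 <= u -> v <= 1 ->
    (forall l, m l \in `[u, v] /\
      forall m', m' \in `[u, v] -> W m' - l * m' <= W (m l) - l * m l) ->
    forall l l', `|(W (m l) - l * m l) - (W (m l') - l' * m l')| <= `|l - l'|.
  move=> u0 v1 mP.
  have half l l' : (W (m l') - l' * m l') - (W (m l) - l * m l) <= `|l - l'|.
    have [mI' _] := mP l'; have [_ /(_ _ mI') mM] := mP l.
    have : (W (m l') - l' * m l') - (W (m l) - l * m l) <= (l - l') * m l'
      by lra.
    move=> /le_trans; apply; apply: (le_trans (ler_norm _)).
    move: mI'; rewrite in_itv/= => /andP[um mv].
    by rewrite normrM ler_piMr// ger0_norm ?(le_trans u0)// (le_trans mv).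
  move=> l l'; rewrite ler_norml; apply/andP; split.
    by rewrite lerNl opprB.
  by rewrite distrC.
(* Best penalized values over the masses at least [k] and over the masses at most [k]. *)
pose A l := W (mA l) - l * mA l; pose B l := W (mB l) - l * mB l.
have cAB : {within `[- C, C], continuous (fun l => A l - B l)}.
  apply: (@lipschitz_within_continuous _ _ _ _ 2) => l l' _ _.
  have -> : A l - B l - (A l' - B l') = (A l - A l') - (B l - B l') by ring.
  rewrite (le_trans (ler_normB _ _))// mulr2n mulrDl mul1r lerD//.
    by apply: (maxlip k 1).
  by apply: (maxlip 0 k).
have [k01 kk1 k0k] : [/\ 0 <= k <= 1, k \in `[k, 1] & k \in `[0, k]].
  by rewrite !in_itv/= !lexx k0 k1.
(* At [l = - C] the map [W m + C m] is non-decreasing, so over masses at most [k] it is largest at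
   [k], which is also a candidate for [A]. *)
have ABN : 0 <= A (- C) - B (- C).
  have [_ /(_ _ kk1) Ak] := mAP (- C); rewrite subr_ge0 (le_trans _ Ak)// /B.
  have [] := mBP (- C); rewrite in_itv/= => /andP[m0 mk] _.
  have := Wlip (mB (- C)) k; rewrite m0 (le_trans mk)// k0 k1 => /(_ erefl
    erefl).
  by rewrite distrC (distrC _ k) (ger0_norm (_ : 0 <= k - _)) ?subr_ge0//
    ler_norml => /andP[]; lra.
(* Symmetrically, [W m - C m] is non-increasing. *)
have ABP : A C - B C <= 0.
  have [_ /(_ _ k0k) Bk] := mBP C; rewrite subr_le0 (le_trans _ Bk)// /A.
  have [] := mAP C; rewrite in_itv/= => /andP[km m1] _.
  have := Wlip (mA C) k; rewrite m1 (le_trans k0)// k0 k1 => /(_ erefl erefl).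
  by rewrite (ger0_norm (_ : 0 <= _ - k)) ?subr_ge0// ler_norml => /andP[]; lra.
have [||l _ /eqP] := @IVT R (fun l => A l - B l) (- C) C 0 _ cAB.
- by rewrite (le_trans _ C0)// oppr_le0.
- by rewrite ge_min ABP orbT le_max ABN.
rewrite subr_eq0 => /eqP ABl.
exists l, (A l) => value.
have vE t p : 0 <= p <= 1 ->
    value t p = W (E mu (cutoff t p)) - l * E mu (cutoff t p).
  move=> p01; rewrite /value integral_lagrangian// ?WE//.
  exact: cutoff_bounded_measurable.
split.
- move=> t p It p01; rewrite vE//; set m := E mu _.
  have m0 : 0 <= m by apply: Rintegral_ge0 => x _;
    case/andP: (cutoff_itv t x p01).
  have m1 : m <= 1.
    rewrite -[leRHS](bounded_integral_cst mI muI);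
      apply: bounded_integral_le => //.
    - exact: cutoff_bounded_measurable.
    - exact: bounded_measurable_cst.
    - by move=> x _; case/andP: (cutoff_itv t x p01).
  have [km|mk] := leP k m.
    by have [_] := mAP l; apply; rewrite in_itv/= km.
  by rewrite ABl; have [_] := mBP l; apply; rewrite in_itv/= m0 ltW.
- have [] := mAP l; rewrite in_itv/= => /andP[km m1] _.
  have /tpP[It p01 mE] : 0 <= mA l <= 1 by rewrite (le_trans k0).
  exists (tp (mA l)).1, (tp (mA l)).2; split; rewrite ?mE//.
  by rewrite vE// mE.
- have [] := mBP l; rewrite in_itv/= => /andP[m0 mk] _.
  have /tpP[It p01 mE] : 0 <= mB l <= 1 by rewrite m0 (le_trans mk).
  exists (tp (mB l)).1, (tp (mB l)).2; split; rewrite ?mE//.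
  by rewrite vE// mE.
Qed.

(* At a maximum, moving to another cutoff without losing value changes the rule
   only on a null set. *)
Lemma cutoff_maximizer_unique mu f (S : R) t p t' p' : bm f ->
  0 <= p <= 1 -> 0 <= p' <= 1 ->
  E mu (fun x => cutoff t p x * f x) = S ->
  E mu (fun x => cutoff t' p' x * f x) <= S ->
  (forall x, I x -> cutoff t' p' x <> cutoff t p x ->
    0 < (cutoff t' p' x - cutoff t p x) * f x) ->
  E mu (cutoff t' p') = E mu (cutoff t p) /\
  E mu (fun x => cutoff t' p' x * f x) = S.
Proof.
move=> bf p01 p01' tpS tpS' H; have muI := Delta_mass mu.
have bc := cutoff_bounded_measurable a b t p01.
have bc' := cutoff_bounded_measurable a b t' p01'.
have ae : {ae mu, forall x, I x -> cutoff t' p' x = cutoff t p x}.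
  apply: (@integral_crossing_strict _ _ _ _ _ mI muI _ _ f) => //.
  - move=> x Ix; have [->|/eqP cc] := eqVneq (cutoff t' p' x) (cutoff t p x).
      by rewrite subrr mul0r.
    exact/ltW/H.
  - move=> x Ix /(H _ Ix); apply: contraTneq => ->.
    by rewrite mulr0 ltxx.
  - by rewrite tpS.
rewrite -tpS; split; apply: bounded_integral_ae => //.
- exact: bounded_measurableM.
- exact: bounded_measurableM.
- by apply: filterS ae => x /= + Ix => /(_ Ix) ->.
Qed.

(** If [f t >= 0], raising the value at [t] to 1 loses nothing. If [f t < 0], then [f] stays
    negative just to the right, and moving the cutoff there drops only efforts of negative value; by
    maximality the change is null. *)
Lemma closed_maximizer mu f (S : R) t p : {within `[a, b], continuous f} ->
  (forall t p, I t -> 0 <= p <= 1 ->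
    E mu (fun x => cutoff t p x * f x) <= S) ->
  I t -> 0 <= p <= 1 -> 0 < E mu (cutoff t p) ->
  E mu (fun x => cutoff t p x * f x) = S ->
  exists2 t', I t' & E mu (cutoff t p) <= E mu (cutoff t' 1) /\
    E mu (fun x => cutoff t' 1 x * f x) = S.
Proof.
move=> cf cS It p01 E0 tpS; have muI := Delta_mass mu.
have bf := continuous_bounded_measurable ab cf.
have bc := cutoff_bounded_measurable a b t p01.
have bc1 s : bm (cutoff s 1) := cutoff_bounded_measurable a b s one_in01.
have It' := It; move: It'; rewrite /= in_itv/= => /andP[at_ tb].
have [f0|f0] := leP 0 (f t).
  exists t => //; split.
    apply: bounded_integral_le => // x _.
    by rewrite cutoff_le ?one_in01//; right; split => //; case/andP: p01.
  apply/eqP; rewrite eq_le cS ?one_in01//= -tpS.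
  apply: integral_crossing_le => // x Ix; rewrite /cutoff.
  case: ltgtP => [_|_|->]; rewrite ?subrr ?mul0r//.
  by rewrite mulr_ge0// subr_ge0; case/andP: p01.
have key t' p' : I t' -> 0 <= p' <= 1 ->
    (forall x, I x -> cutoff t' p' x <> cutoff t p x ->
      f x < 0 /\ cutoff t' p' x <= cutoff t p x) ->
    E mu (cutoff t' p') = E mu (cutoff t p) /\
    E mu (fun x => cutoff t' p' x * f x) = S.
  move=> It' p01' H; apply: cutoff_maximizer_unique => //; first exact: cS.
  move=> x Ix /[dup] /eqP cc /(H _ Ix) [fx cx].
  by rewrite nmulr_lgt0// subr_lt0 lt_neqAle cc.
have [e e0 fe] := within_continuous_lt0 cf It f0.
(* At [t = b] there is no room on the right, but dropping [b] leaves the zero rule, against the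
   positive mass. *)
have [tb'|tb'] := eqVneq t b.
  have [||b0 _] := key b 0 _ zero_in01.
  - by move: It; rewrite tb'.
  - rewrite tb' => x; rewrite /= in_itv/= => /andP[_ xb]; rewrite /cutoff.
    case: ltgtP xb => // -> _ _; rewrite -tb'; split => //.
    by case/andP: p01.
  move: E0; rewrite -b0.
  suff -> : E mu (cutoff b 0) = 0 by rewrite ltxx.
  rewrite -[RHS](bounded_integral_cst mI muI 0).
  apply: eq_Rintegral => x; rewrite inE /= in_itv/= => /andP[_].
  by rewrite /cutoff; case: ltgtP.
have {}tb' : t < b by rewrite lt_neqAle tb'.
pose t' := Num.min b (t + e / 2).
have e2 : 0 < e / 2 by rewrite divr_gt0.
have tt' : t < t' by rewrite lt_min tb' ltrDl.
have It' : I t'.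
  by rewrite /= in_itv/= ge_min lexx (le_trans at_)// ltW.
exists t' => //; have [|-> ->] := key t' 1 It' one_in01; last by [].
move=> x Ix xne.
have [xt xt'] : t <= x /\ x < t'.
  split; rewrite leNgt || rewrite ltNge; apply/negP => xt; apply: xne.
  - by rewrite /cutoff xt (lt_trans xt).
  - have tx : t < x by rewrite (lt_le_trans tt').
    rewrite /cutoff [x < t']ltNge xt [x < t]ltNge (ltW tx)/= (gt_eqF tx).
    by case: ifP.
split.
  apply: fe => //; rewrite distrC ger0_norm ?subr_ge0//.
  rewrite ltrBlDl (lt_le_trans xt')// ge_min; apply/orP; right.
  by rewrite lerD2l ler_pdivrMr// ler_peMr// ?ler1n// ltW.
by apply: cutoff_le; rewrite ?one_in01//; left.
Qed.

(** Mirror image: lower the value at [t] to 0 if [f t <= 0]; otherwise move the cutoff left, which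
    adds only efforts of positive value. At [t = a] this would give mass one, against the
    hypothesis. *)
Lemma open_maximizer mu f (S : R) t p : {within `[a, b], continuous f} ->
  (forall t p, I t -> 0 <= p <= 1 ->
    E mu (fun x => cutoff t p x * f x) <= S) ->
  I t -> 0 <= p <= 1 -> E mu (cutoff t p) < 1 ->
  E mu (fun x => cutoff t p x * f x) = S ->
  exists2 t', I t' & E mu (cutoff t' 0) <= E mu (cutoff t p) /\
    E mu (fun x => cutoff t' 0 x * f x) = S.
Proof.
move=> cf cS It p01 E1 tpS; have muI := Delta_mass mu.
have bf := continuous_bounded_measurable ab cf.
have bc := cutoff_bounded_measurable a b t p01.
have bc0 s : bm (cutoff s 0) := cutoff_bounded_measurable a b s zero_in01.
have It' := It; move: It'; rewrite /= in_itv/= => /andP[at_ tb].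
have [f0|f0] := leP (f t) 0.
  exists t => //; split.
    apply: bounded_integral_le => // x _.
    by rewrite cutoff_le ?zero_in01//; right; split => //; case/andP: p01.
  apply/eqP; rewrite eq_le cS ?zero_in01//= -tpS.
  apply: integral_crossing_le => // x Ix; rewrite /cutoff.
  case: ltgtP => [_|_|->]; rewrite ?subrr ?mul0r//.
  by rewrite mulr_le0// sub0r oppr_le0; case/andP: p01.
have key t' p' : I t' -> 0 <= p' <= 1 ->
    (forall x, I x -> cutoff t' p' x <> cutoff t p x ->
      0 < f x /\ cutoff t p x <= cutoff t' p' x) ->
    E mu (cutoff t' p') = E mu (cutoff t p) /\
    E mu (fun x => cutoff t' p' x * f x) = S.
  move=> It' p01' H; apply: cutoff_maximizer_unique => //; first exact: cS.
  move=> x Ix /[dup] /eqP cc /(H _ Ix) [fx cx].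
  by rewrite mulr_gt0// subr_gt0 lt_neqAle eq_sym cc.
have cfN : {within `[a, b], continuous (- f)}.
  by move=> x; apply: continuousN; exact: cf.
have [|e e0 fe] := within_continuous_lt0 cfN It; first by rewrite oppr_lt0.
have [ta|ta] := eqVneq t a.
  have [||a1 _] := key a 1 _ one_in01.
  - by move: It; rewrite ta.
  - rewrite ta => x; rewrite /= in_itv/= => /andP[ax _]; rewrite /cutoff.
    case: ltgtP ax => // -> _ _; rewrite -ta; split => //.
    by case/andP: p01.
  move: E1; rewrite -a1.
  suff -> : E mu (cutoff a 1) = 1 by rewrite ltxx.
  rewrite -[RHS](bounded_integral_cst mI muI 1).
  apply: eq_Rintegral => x; rewrite inE /= in_itv/= => /andP[+ _].
  by rewrite /cutoff; case: ltgtP.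
have {}ta : a < t by rewrite lt_neqAle eq_sym ta.
pose t' := Num.max a (t - e / 2).
have e2 : 0 < e / 2 by rewrite divr_gt0.
have tt' : t' < t by rewrite gt_max ta gtrBl.
have It' : I t'.
  by rewrite /= in_itv/= le_max lexx (le_trans (ltW tt')).
exists t' => //; have [|-> ->] := key t' 0 It' zero_in01; last by [].
move=> x Ix xne.
have [xt xt'] : x <= t /\ t' < x.
  split; rewrite leNgt || rewrite ltNge; apply/negP => xt; apply: xne.
  - have tx : t' < x by rewrite (lt_trans tt').
    by rewrite /cutoff ![x < _]ltNge (ltW tx) (ltW xt)/= (gt_eqF tx)
      (gt_eqF xt).
  - have tx : x < t by rewrite (le_lt_trans xt).
    by rewrite /cutoff tx; case: ltgtP xt.
split.
  rewrite -oppr_lt0; apply: fe => //; rewrite ger0_norm ?subr_ge0//.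
  rewrite ltrBlDl -ltrBlDr (le_lt_trans _ xt')// le_max; apply/orP; right.
  by rewrite lerD2l lerN2 ler_pdivrMr// ler_peMr// ?ler1n// ltW.
by apply: cutoff_le; rewrite ?zero_in01//; left.
Qed.

Lemma two_step_monotone_rule x' x'' p : x' <= x'' -> 0 <= p <= 1 ->
  monotone_rule a b (two_step x' x'' p).
Proof.
move=> xx /andP[p0 p1]; split => [x _|x y _ _ xy]; rewrite /two_step.
  by case: ifP => _; [|case: ifP => _]; rewrite ?lexx ?ler01 ?p0.
case: (ltP x x') => xx'; first by do 2 case: ifP => //.
rewrite ltNge (le_trans xx' xy)/=; case: (leP x x'') => xx''.
  by case: ifP.
by rewrite [y <= _]leNgt (lt_le_trans xx'' xy).
Qed.

(** The closed maximizer has mass at least [k] and the open one mass at most [k]; a mixture of mass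
    [k] keeps the maximal penalized value [S]. *)
Lemma two_step_optimum_exists mu f (k : R) : {within `[a, b], continuous f} ->
  0 < k < 1 ->
  exists x' x'' p, [/\ [/\ I x', I x'', x' <= x'' & 0 <= p <= 1],
    E mu (two_step x' x'' p) = k &
    forall q, monotone_rule a b q -> E mu q = k ->
      E mu (fun x => q x * f x) <= E mu (fun x => two_step x' x'' p x * f x)].
Proof.
move=> cf /andP[k0 k1]; have muI := Delta_mass mu.
have bf := continuous_bounded_measurable ab cf.
have [|l [S [cS [t1 [p1 [It1 p101 kt1 vt1]]] [t2 [p2 [It2 p201 kt2 vt2]]]]]] :=
  @lagrange_multiplier mu f k bf; first by rewrite !ltW.
have cfl : {within `[a, b], continuous (fun x => f x - l)}.
  by move=> x; apply: continuousB; [exact: cf|exact: cst_continuous].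
have bfl := continuous_bounded_measurable ab cfl.
have [|x' Ix' [mx' vx']] := closed_maximizer cfl cS It1 p101 _ vt1.
  exact: lt_le_trans kt1.
have [|x'' Ix'' [mx'' vx'']] := open_maximizer cfl cS It2 p201 _ vt2.
  exact: le_lt_trans k1.
have {mx' kt1} kx' := le_trans kt1 mx'.
have {mx'' kt2} kx'' := le_trans mx'' kt2.
have bc1 s : bm (cutoff s 1) := cutoff_bounded_measurable a b s one_in01.
have bc0 s : bm (cutoff s 0) := cutoff_bounded_measurable a b s zero_in01.
(* Attaining [S] with mass [k] suffices: by the layer-cake bound no monotone rule exceeds [S], and
   at mass [k] the price term is the same for all. *)
suff [y' [y'' [p [H Ek ES]]]] : exists y' y'' p,
    [/\ [/\ I y', I y'', y' <= y'' & 0 <= p <= 1],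
    E mu (two_step y' y'' p) = k &
    E mu (fun x => two_step y' y'' p x * (f x - l)) = S].
  exists y', y'', p; split => // q mq qk.
  have [_ _ yy p01] := H.
  have b2 := monotone_rule_bounded_measurable (two_step_monotone_rule yy p01).
  have bq := monotone_rule_bounded_measurable mq.
  have := layer_cake_le bfl mq cS.
  by rewrite -ES !integral_lagrangian// qk Ek lerD2r.
have [xx|xx] := leP x' x''.
  have [|p p01 kE] :=
    @convex_comb_between R (E mu (cutoff x'' 0)) (E mu (cutoff x' 1)) k.
    by rewrite kx''.
  have bd : bm (fun x => cutoff x' 1 x - cutoff x'' 0 x)
    by exact: bounded_measurableB.
  have bp : bm (fun=> p) := bounded_measurable_cst _ _.
  exists x', x'', p; split => //.
    rewrite kE -bounded_integralB// -bounded_integralZ// -bounded_integralD//.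
      by apply: eq_Rintegral => x _; exact: two_stepE.
    exact: bounded_measurableM.
  have -> : E mu (fun x => two_step x' x'' p x * (f x - l)) =
      E mu (fun x => cutoff x'' 0 x * (f x - l)) +
      p * E mu (fun x => (cutoff x' 1 x - cutoff x'' 0 x) * (f x - l)).
    rewrite -bounded_integralZ// -?bounded_integralD//; last 3 first.
    - exact: bounded_measurableM.
    - by do 2 apply: bounded_measurableM => //.
    - exact: bounded_measurableM.
    by apply: eq_Rintegral => x _; rewrite two_stepE//; ring.
  by rewrite integral_diffM// vx' vx'' subrr mulr0 addr0.
(* Here [x'' < x'], so the closed half-line at [x'] lies inside the open one at [x''], which forces
   its mass to equal [k]. *)
exists x', x', 1; rewrite one_in01 lexx two_step_cutoff; split => //.
apply/eqP; rewrite eq_le kx' andbT (le_trans _ kx'')//.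
apply: bounded_integral_le => // x _.
by apply: cutoff_le; rewrite ?zero_in01 ?one_in01//; left.
Qed.

End pointwise_optimum.

(** * Borel measurability of the optimal value in the competition *)

Section measurability.
Context (R : realType) (a b : R) (ab : a <= b).
Implicit Types (mu : Delta ab) (f q g : R -> R).

Local Notation I := (`[a, b]%classic : set (measurableTypeR R)).
Local Notation bm := (@bounded_measurable R _ (measurableTypeR R) I).
Local Notation E mu f := (\int[mu : Delta ab]_(x in I) f x).
Let mI : measurable I := measurable_segment a b.

(** Covers both rescalings used for the penalty: [v q] and [1 - v + v q]. *)
Lemma monotone_rule_affine q (u v : R) : monotone_rule a b q -> 0 <= v ->
  0 <= u -> u + v <= 1 -> monotone_rule a b (fun x => u + v * q x).
Proof.
move=> [q01 qh] v0 u0 uv; split=> [x Ix|x y Ix Iy xy].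
  have /andP[q0 q1] := q01 _ Ix; rewrite addr_ge0 ?mulr_ge0//=.
  by rewrite (le_trans _ uv)// lerD2l ler_piMr.
by rewrite lerD2l ler_wpM2l// qh.
Qed.

(* Rescaling [q] (or [1 - q]) restores the constraint at a cost of at most [C]
   per unit of excess (or missing) mass. *)
Lemma exact_penalty mu f q (k C V : R) : 0 < k < 1 -> bm f ->
  (forall x, I x -> `|f x| <= C) -> monotone_rule a b q ->
  (forall q', monotone_rule a b q' -> E mu q' = k ->
    E mu (fun x => q' x * f x) <= V) ->
  E mu (fun x => q x * f x) - C * `|E mu q - k| <= V.
Proof.
move=> /andP[k0 k1] bf fC mq qV; have muI := Delta_mass mu.
have bq := monotone_rule_bounded_measurable mq; case: (mq) => q01 _.
set m := E mu q.
suff [q' [mq' Eq' q'q]] : exists q', [/\ monotone_rule a b q', E mu q' = k &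
    `|E mu (fun x => q' x * f x) - E mu (fun x => q x * f x)| <= C * `|m - k|].
  have := qV _ mq' Eq'; move: q'q; rewrite ler_norml => /andP[+ _].
  by rewrite lerBrDl => H; apply: le_trans.
have [km|mk] := leP k m.
- have m0 : 0 < m by exact: lt_le_trans km.
  have v0 : 0 <= k / m by rewrite divr_ge0 ?ltW.
  have v1 : k / m <= 1 by rewrite ler_pdivrMr// mul1r.
  have mq' : monotone_rule a b (fun x => 0 + k / m * q x).
    by apply: monotone_rule_affine; rewrite ?add0r.
  have bq' := monotone_rule_bounded_measurable mq'.
  have Eq' : E mu (fun x => 0 + k / m * q x) = k.
    under eq_Rintegral do rewrite add0r.
    by rewrite bounded_integralZ// divfK// gt_eqF.
  exists (fun x => 0 + k / m * q x); split => //.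
  rewrite (@ger0_norm _ (m - k)) ?subr_ge0// -[in leRHS]Eq'.
  apply: integral_ordered_lipschitz => // x Ix.
  by case/andP: (q01 _ Ix) => q0 _; rewrite add0r ler_piMl.
- have m1 : 0 < 1 - m by rewrite subr_gt0 (lt_trans mk).
  (* Scaling [1 - q] by [v] brings its mass from [1 - m] down to [1 - k]; the resulting rule lies
     above [q]. *)
  pose v := (1 - k) / (1 - m).
  have v0 : 0 <= v by rewrite divr_ge0 ?subr_ge0 ?ltW// (lt_trans mk).
  have v1 : v <= 1 by rewrite ler_pdivrMr// mul1r lerD2l lerN2 ltW.
  have mq' : monotone_rule a b (fun x => 1 - v + v * q x).
    by apply: monotone_rule_affine; rewrite ?subr_ge0 ?subrK.
  have bq' := monotone_rule_bounded_measurable mq'.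
  have Eq' : E mu (fun x => 1 - v + v * q x) = k.
    have bc c : bm (fun=> c) := bounded_measurable_cst _ _.
    rewrite bounded_integralD ?bounded_integral_cst ?bounded_integralZ//;
      last first.
      exact: bounded_measurableM.
    rewrite -/m; have -> : 1 - v + v * m = 1 - v * (1 - m) by ring.
    by rewrite divfK ?gt_eqF//; ring.
  exists (fun x => 1 - v + v * q x); split => //.
  rewrite distrC (@ltr0_norm _ (m - k)) ?subr_lt0// opprB -[in leRHS]Eq'.
  apply: integral_ordered_lipschitz => // x Ix.
  have /andP[_ q1] := q01 _ Ix.
  have : 0 <= (1 - v) * (1 - q x) by rewrite mulr_ge0 ?subr_ge0.
  by lra.
Qed.

(** Continuous approximation of [cutoff s p]: the line of slope [n] through [(s, p)], clipped to
    [[0, 1]]. *)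
Definition ramp (n : nat) (s p x : R) : R :=
  Num.max 0 (Num.min 1 (p + n%:R * (x - s))).

Lemma ramp_monotone_rule n s p : monotone_rule a b (ramp n s p).
Proof.
split=> [x _|x y _ _ xy]; rewrite /ramp.
  by rewrite le_max lexx/= ge_max ler01 ge_min lexx.
have h : p + n%:R * (x - s) <= p + n%:R * (y - s).
  by rewrite lerD2l ler_wpM2l// lerD2r.
by rewrite ge_max !le_max lexx/= le_min !ge_min lexx h !orbT.
Qed.

Lemma ramp_continuous n s p : continuous (ramp n s p : R -> R).
Proof.
have -> : ramp n s p =
    (fun=> 0) \max ((fun=> 1) \min (fun x => p + n%:R * (x - s))) by [].
apply: max_fun_continuous; first exact: cst_continuous.
apply: min_fun_continuous; first exact: cst_continuous.
move=> x; apply: (@cvgD _ R^o); first exact: cvg_cst.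
apply: cvgMr; apply: (@cvgB _ R^o); [exact: cvg_id|exact: cvg_cst].
Qed.

Lemma ramp_cvg s p x : 0 <= p <= 1 ->
  (fun n => ramp n s p x) @ \oo --> cutoff s p x.
Proof.
move=> /andP[p0 p1]; apply: cvg_near_cst; rewrite /cutoff /ramp.
case: ltgtP => [xs|sx|->].
- near=> n; rewrite max_l// ge_min; apply/orP; right.
  rewrite -opprB mulrN subr_le0 (le_trans p1)// -ler_pdivrMr ?subr_gt0//.
  by near: n; exact: nbhs_infty_ger.
- near=> n; rewrite min_l ?max_r// (@le_trans _ _ (n%:R * (x - s)))//;
  last first.
    by rewrite lerDr.
  rewrite -ler_pdivrMr ?subr_gt0//.
  by near: n; exact: nbhs_infty_ger.
- by apply: nearW => n; rewrite subrr mulr0 addr0 min_r// max_r.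
Unshelve. all: by end_near. Qed.

Lemma continuous_test_integral (g : test_fun a b) :
  continuous (test_integral g : Delta ab -> R).
Proof.
move=> mu; have [+ _] := @weak_cvgP R a b ab (nbhs mu) mu _.
by apply; exact: cvg_id.
Qed.

(** For a fixed continuous [g], its mass and its value are weakly continuous in the competition. *)
Lemma penalized_open g f (k C c : R) : {within `[a, b], continuous g} ->
  {within `[a, b], continuous f} ->
  open [set mu : Delta ab |
    c < E mu (fun x => g x * f x) - C * `|E mu g - k|].
Proof.
move=> cg cf.
have cgf : {within `[a, b], continuous (fun x => g x * f x)}.
  by move=> x; apply: continuousM; [exact: cg|exact: cf].
pose J (mu : Delta ab) : R := test_integral (exist _ _ cgf : test_fun a b) mu -
  C * `|test_integral (exist _ _ cg : test_fun a b) mu - k|.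
rewrite (_ : [set mu | _] = J @^-1` [set x | c < x]); last by [].
apply: open_comp; last exact: open_gt.
move=> mu _; have ct h := @continuous_test_integral h mu.
suff : J x @[x --> mu] --> J mu by [].
apply: (@cvgB _ _ _ (nbhs mu)); first exact: ct.
apply: cvgMr; apply: cvg_norm.
by apply: (@cvgB _ _ _ (nbhs mu)); [exact: ct|exact: cvg_cst].
Qed.

Lemma two_step_ramp_cvg x' x'' p x : x' <= x'' ->
  (fun n => ramp n x'' 0 x + p * (ramp n x' 1 x - ramp n x'' 0 x)) @ \oo -->
  two_step x' x'' p x.
Proof.
move=> xx; rewrite two_stepE//; apply: cvgD; first exact/ramp_cvg/zero_in01.
by apply: cvgMr; apply: cvgB; apply: ramp_cvg; rewrite ?zero_in01 ?one_in01.
Qed.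

(** Measurability is obtained for the value, not for the selected parameters: each strict upper
    level set of the value is a union of weakly open sets. *)
Lemma two_step_optimum_measurable (f : R -> R) (k : R)
    (x' x'' p : Delta ab -> R) :
  0 < k < 1 -> {within `[a, b], continuous f} ->
  (forall mu, [/\ x' mu <= x'' mu, 0 <= p mu <= 1 &
    E mu (two_step (x' mu) (x'' mu) (p mu)) = k]) ->
  (forall mu q, monotone_rule a b q -> E mu q = k ->
    E mu (fun x => q x * f x) <=
    E mu (fun x => two_step (x' mu) (x'' mu) (p mu) x * f x)) ->
  measurable_fun [set: borelDelta ab] (fun mu : borelDelta ab =>
    E mu (fun x => two_step (x' mu) (x'' mu) (p mu) x * f x)).
Proof.
move=> k01 cf ts opt; have bf := continuous_bounded_measurable ab cf.
have [C fC] : exists C, forall x, I x -> `|f x| <= C by case: bf.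
apply: (measurability _ (RGenOInfty.measurableE R)) => _ /= [_ [c ->]] <-.
rewrite setTI; apply: sub_sigma_algebra.
pose G := [set g | {within `[a, b], continuous g} /\ monotone_rule a b g].
rewrite (_ : _ @^-1` _ = \bigcup_(g in G) [set mu : Delta ab |
    c < E mu (fun x => g x * f x) - C * `|E mu g - k|]); last first.
  (* The exact penalty keeps every [g] below the optimum; conversely, ramps approximate the optimal
     two-step rule, and their penalty vanishes in the limit. *)
  apply/seteqP; split => mu /=; rewrite in_itv/= andbT; last first.
    by move=> [g [cg mg] /= cE]; rewrite (lt_le_trans cE)// exact_penalty//;
      exact: opt.
  move=> cE; have [xx p01 Ek] := ts mu; have muI := Delta_mass mu.
  pose g n x :=
    ramp n (x'' mu) 0 x + p mu * (ramp n (x' mu) 1 x - ramp n (x'' mu) 0 x).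
  have gG n : G (g n).
    split.
      move=> x; apply: continuousD.
        exact/continuous_subspaceT/ramp_continuous.
      apply: continuousM; first exact: cst_continuous.
      by apply: continuousB; exact/continuous_subspaceT/ramp_continuous.
    (* Written as a convex combination, the approximation is visibly a monotone rule. *)
    have -> : g n = fun x =>
        (1 - p mu) * ramp n (x'' mu) 0 x + p mu * ramp n (x' mu) 1 x.
      by apply/funext => x; rewrite /g; ring.
    have [r01 rh] := ramp_monotone_rule n (x'' mu) 0.
    have [s01 sh] := ramp_monotone_rule n (x' mu) 1.
    case/andP: p01 => p0 p1.
    split=> [x Ix|x y Ix Iy xy]; last first.
      by rewrite lerD// ler_wpM2l ?subr_ge0// ?rh ?sh.
    have /andP[r0 r1] := r01 _ Ix; have /andP[s0 s1] := s01 _ Ix.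
    rewrite addr_ge0 ?mulr_ge0 ?subr_ge0//=.
    rewrite (@le_trans _ _ (1 - p mu + p mu))//; last by rewrite subrK.
    by rewrite lerD// ler_piMr ?subr_ge0.
  have bg n : bm (g n) by case: (gG n) => _ /monotone_rule_bounded_measurable.
  have bt :=
    monotone_rule_bounded_measurable (two_step_monotone_rule a b xx p01).
  have g1 n x : I x -> `|g n x| <= 1.
    by case: (gG n) => _ [g01 _] /g01 /andP[g0 g1]; rewrite ger0_norm.
  have cvg1 : (fun n => E mu (g n)) @ \oo --> k.
    rewrite -Ek; apply: (@bounded_integral_cvg _ _ _ _ _ mI muI _ _ 1) => //.
      by move=> n; case: (bg n).
    by move=> x _; exact: two_step_ramp_cvg.
  have cvg2 : (fun n => E mu (fun x => g n x * f x)) @ \oo -->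
      E mu (fun x => two_step (x' mu) (x'' mu) (p mu) x * f x).
    apply: (@bounded_integral_cvg _ _ _ _ _ mI muI _ _ C) => //.
    - by move=> n; case: (bounded_measurableM (bg n) bf).
    - exact: bounded_measurableM.
    - move=> n x Ix; rewrite normrM -[leRHS]mul1r ler_pM ?g1 ?fC//.
    - by move=> x _; apply: cvgMl; exact: two_step_ramp_cvg.
  have cvg3 :
      (fun n => E mu (fun x => g n x * f x) - C * `|E mu (g n) - k|) @ \oo -->
      E mu (fun x => two_step (x' mu) (x'' mu) (p mu) x * f x).
    rewrite -[X in _ --> X]subr0 -[X in _ - X](mulr0 C) -(normr0 R) -(subrr k).
    by apply: cvgB => //; apply: cvgMr; apply: cvg_norm; apply: cvgB => //;
      exact: cvg_cst.
  have [n _ /(_ n (leqnn n))] := @cvgr_gt _ _ _ _ _ _ cvg3 c cE.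
  by exists (g n).
(* The family of all [g] may be uncountable: openness, unlike measurability, survives arbitrary
   unions. *)
by apply: bigcup_open => g [cg _]; exact: penalized_open.
Qed.

End measurability.

(** * From fixed competitions to the designer's problem *)

Section optimal_rules.
Context (R : realType) (a b : R) (ab : a <= b) (k : R).
Context (pi : R -> R) (M : probability (borelDelta ab) R).
Hypotheses (k01 : 0 < k < 1) (pi_cont : {within `[a, b], continuous pi}).
Implicit Types (mu : Delta ab) (q : R -> Delta ab -> R).

Local Notation I := (`[a, b]%classic : set (measurableTypeR R)).
Local Notation bm := (@bounded_measurable R _ (measurableTypeR R) I).
Local Notation E mu f := (\int[mu : Delta ab]_(x in I) f x).
Let mI : measurable I := measurable_segment a b.
Let bpi : bm pi := continuous_bounded_measurable ab pi_cont.

Lemma allocation_ruleP q : allocation_rule k q <->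
  forall mu, monotone_rule a b (q ^~ mu) /\ E mu (q ^~ mu) = k.
Proof.
split=> [[q01 qh qk] mu|H].
  have mq : monotone_rule a b (q ^~ mu) by split=> [x Ix|];
    [exact: q01|exact: qh].
  have bq := monotone_rule_bounded_measurable mq; split=> //.
  by have := qk mu; rewrite (bounded_integralE mI (Delta_mass mu))// => -[].
split=> [x mu Ix|mu|mu]; have [mq Eq] := H mu; [|by case: mq|].
  by case: mq => + _; apply.
have bq := monotone_rule_bounded_measurable mq.
by rewrite (bounded_integralE mI (Delta_mass mu))// Eq.
Qed.

Definition interim_value q (mu : borelDelta ab) : R :=
  E (mu : Delta ab) (fun x => q x mu * pi x).

Lemma interim_payoffE q : allocation_rule k q ->
  interim_payoff pi q = EFin \o interim_value q.
Proof.
move=> /allocation_ruleP Hq; apply/funext => mu; have [mq _] := Hq mu.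
rewrite /interim_payoff (bounded_integralE mI (Delta_mass mu))//.
exact: bounded_measurableM (monotone_rule_bounded_measurable mq) bpi.
Qed.

Lemma interim_value_bounded_measurable q : feasible k pi q ->
  bounded_measurable [set: borelDelta ab] (interim_value q).
Proof.
move=> [rq mq]; split.
  by apply/measurable_EFinP; rewrite -interim_payoffE.
have [_ [C piC]] := bpi; exists C => mu _.
have /allocation_ruleP /(_ mu) [mqm _] := rq.
have bqm := monotone_rule_bounded_measurable mqm.
have bqp := bounded_measurableM bqm bpi; have muI := Delta_mass mu.
rewrite (le_trans (bounded_integral_norm mI muI bqp))//.
rewrite -(bounded_integral_cst mI muI C); apply: bounded_integral_le => //.
- exact: bounded_measurable_norm.
- exact: bounded_measurable_cst.
move=> x Ix; have /andP[q0 q1] := mqm.1 x Ix.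
by rewrite normrM -[leRHS]mul1r ler_pM ?piC// ger0_norm.
Qed.

Lemma designer_payoffE q : feasible k pi q ->
  designer_payoff pi M q = (\int[M]_mu interim_value q mu)%:E.
Proof.
move=> fq; rewrite /designer_payoff interim_payoffE; last by case: fq.
rewrite -(bounded_integralE _ (probability_setT M))//.
exact: interim_value_bounded_measurable.
Qed.

(** Optimality at every competition integrates to optimality under [M]; the two-step form makes the
    payoff measurable. Cutoff and constant rules are special cases. *)
Lemma two_step_optimal q (x' x'' p : Delta ab -> R) :
  (forall mu, x' mu <= x'' mu /\ 0 <= p mu <= 1) ->
  (forall mu x, I x -> q x mu = two_step (x' mu) (x'' mu) (p mu) x) ->
  (forall mu, E mu (q ^~ mu) = k) ->
  (forall mu r, monotone_rule a b r -> E mu r = k ->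
    E mu (fun x => r x * pi x) <= E mu (fun x => q x mu * pi x)) ->
  optimal k pi M q.
Proof.
move=> xp qE qk qopt.
have qEE mu : E mu (two_step (x' mu) (x'' mu) (p mu)) = k.
  by rewrite -(qk mu); apply: eq_Rintegral => x; rewrite inE => /qE ->.
have qpE mu : E mu (fun x => two_step (x' mu) (x'' mu) (p mu) x * pi x) =
    E mu (fun x => q x mu * pi x).
  by apply: eq_Rintegral => x; rewrite inE => /qE ->.
have rq : allocation_rule k q.
  apply/allocation_ruleP => mu; split=> //; have [xx p01] := xp mu.
  have [t01 th] := two_step_monotone_rule a b xx p01.
  split=> [x Ix|x y Ix Iy xy]; first by rewrite qE// t01.
  by rewrite !qE// th.
have fq : feasible k pi q.
  split=> //; rewrite interim_payoffE//; apply/measurable_EFinP.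
  have -> : interim_value q = fun mu : borelDelta ab =>
      E mu (fun x => two_step (x' mu) (x'' mu) (p mu) x * pi x).
    by apply/funext => mu; rewrite /interim_value qpE.
  apply: (two_step_optimum_measurable k01) => // [mu|mu r mr rk].
    by have [xx p01] := xp mu.
  by rewrite qpE; exact: qopt.
split; [exact: fq|move=> q' fq'];
  rewrite (designer_payoffE fq') (designer_payoffE fq) lee_fin.
apply: bounded_integral_le => //; first exact: probability_setT.
- exact: interim_value_bounded_measurable.
- exact: interim_value_bounded_measurable.
move=> mu _; have [/allocation_ruleP /(_ mu)[mq' q'k] _] := fq'.
exact: qopt.
Qed.

(** Both rules have the same integrated payoff while [q'] is best at every competition, so the
    interim values agree for [M]-almost every competition, where uniqueness at a fixed competition
    applies. *)
Lemma optimal_ae_same_rule q q' : optimal k pi M q' -> optimal k pi M q ->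
  (forall mu r, monotone_rule a b r -> E mu r = k ->
    E mu (fun x => r x * pi x) <= E mu (fun x => q' x mu * pi x)) ->
  (forall mu r, monotone_rule a b r -> E mu r = k ->
    E mu (fun x => q' x mu * pi x) <= E mu (fun x => r x * pi x) ->
    {ae mu, forall x, I x -> r x = q' x mu}) ->
  ae_same_rule M q q'.
Proof.
move=> [fq' opt'] [fq opt] q'opt q'uniq.
have [/allocation_ruleP qP _] := fq.
have MT := probability_setT M.
have bq := interim_value_bounded_measurable fq.
have bq' := interim_value_bounded_measurable fq'.
have Mqq' : \int[M]_mu interim_value q mu = \int[M]_mu interim_value q' mu.
  have := opt' _ fq; have := opt _ fq'.
  rewrite (designer_payoffE fq) (designer_payoffE fq') !lee_fin => le1 le2.
  exact: (le_anti (introT andP (conj le2 le1))).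
have := bounded_integral_eq_le measurableT MT bq bq' _ Mqq'.
move=> /(_ (fun mu _ => q'opt mu _ (qP mu).1 (qP mu).2)).
apply: filterS => mu /(_ Logic.I); rewrite /interim_value => qq'.
by have [mq qk] := qP mu; apply: q'uniq => //; rewrite qq'.
Qed.

Lemma crossing_optimum mu (q r : R -> R) (l : R) : bm q -> bm r ->
  E mu r = E mu q -> (forall x, I x -> 0 <= (q x - r x) * (pi x - l)) ->
  E mu (fun x => r x * pi x) <= E mu (fun x => q x * pi x).
Proof.
move=> bq br rq qr; have bl : bm (fun x => pi x - l).
  by apply: bounded_measurableB => //; exact: bounded_measurable_cst.
have := integral_crossing_le mI (Delta_mass mu) bq br bl qr.
by rewrite !(integral_lagrangian mI (Delta_mass mu))// rq lerD2r.
Qed.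

(** The product [(q - r) (pi - pi c)] vanishes almost everywhere, so the rules agree off [c]; equal
    masses settle [c] itself. *)
Lemma crossing_optimum_unique mu (q r : R -> R) (c : R) : bm q -> bm r ->
  E mu r = E mu q -> (forall x, I x -> 0 <= (q x - r x) * (pi x - pi c)) ->
  (forall x, I x -> x <> c -> pi x <> pi c) ->
  E mu (fun x => q x * pi x) <= E mu (fun x => r x * pi x) ->
  {ae mu, forall x, I x -> r x = q x}.
Proof.
move=> bq br rq qr pic; have bl : bm (fun x => pi x - pi c).
  by apply: bounded_measurableB => //; exact: bounded_measurable_cst.
move=> Eqr; apply: (integral_eq_off_point mI (Delta_mass mu) (c := c)) => //.
have : E mu (fun x => q x * (pi x - pi c)) <=
    E mu (fun x => r x * (pi x - pi c)).
  by rewrite !(integral_lagrangian mI (Delta_mass mu))// rq lerD2r.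
move=> /(integral_crossing_eq mI (Delta_mass mu) bq br bl qr).
apply: filterS => x H Ix xc; move/eqP : (H Ix).
by rewrite mulf_eq0 !subr_eq0 => /orP[/eqP ->//|/eqP /(pic _ Ix xc)].
Qed.

Lemma cutoff_crossing (r : R -> R) (t p x : R) : monotone_rule a b r ->
  {in `[a, b] &, {homo pi : x y / x <= y}} -> I t -> I x ->
  0 <= (cutoff t p x - r x) * (pi x - pi t).
Proof.
move=> [r01 _] pih It Ix; have /andP[r0 r1] := r01 _ Ix; rewrite /cutoff.
case: ltgtP => [xt|tx|->]; last by rewrite subrr mulr0.
- have pxt : pi x - pi t <= 0 by rewrite subr_le0 pih// ltW.
  by rewrite mulr_le0// sub0r oppr_le0.
- have ptx : 0 <= pi x - pi t by rewrite subr_ge0 pih// ltW.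
  by rewrite mulr_ge0// subr_ge0.
Qed.

(** Take for [c] the start of the level set where [r] is at least [k]: before it [r] is below [k]
    and [pi] is at least [pi c], after it both inequalities turn. *)
Lemma constant_crossing (r : R -> R) : monotone_rule a b r ->
  {in `[a, b] &, {homo pi : x y / x <= y >-> y <= x}} ->
  exists2 c, I c & forall x, I x -> 0 <= (k - r x) * (pi x - pi c).
Proof.
move=> mr pih; have [c [p [Ic p01 kr]]] := level_set_cutoff ab k mr.
exists c => // x Ix; have := kr x Ix; rewrite /cutoff.
case: ltgtP => [xc|cx|-> _]; last by rewrite subrr mulr0.
- case: leP => [_ /eqP|rk _]; first by rewrite oner_eq0.
  have pcx : 0 <= pi x - pi c by rewrite subr_ge0 pih// ltW.
  by rewrite mulr_ge0// subr_ge0 ltW.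
- case: leP => [kr' _|_ /esym/eqP]; last by rewrite oner_eq0.
  have pxc : pi x - pi c <= 0 by rewrite subr_le0 pih// ltW.
  by rewrite mulr_le0// subr_le0.
Qed.

Lemma cutoff_solutionP mu (t p : R) : cutoff_solution k mu t p <->
  [/\ I t, 0 <= p <= 1 & E mu (cutoff t p) = k].
Proof.
split=> -[It p01 tk].
  have p01' : 0 <= p <= 1 by move: p01; rewrite in_itv.
  have bc := cutoff_bounded_measurable a b t p01'.
  by split => //; move: tk; rewrite (bounded_integralE mI (Delta_mass mu))// =>
    -[].
have bc := cutoff_bounded_measurable a b t p01.
by split; rewrite ?in_itv// (bounded_integralE mI (Delta_mass mu))// tk.
Qed.

(** Two cutoff rules are ordered, and ordered rules of equal mass agree almost everywhere. *)
Lemma cutoff_solution_ae mu (t1 p1 t2 p2 : R) :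
  cutoff_solution k mu t1 p1 -> cutoff_solution k mu t2 p2 ->
  {ae mu, forall x, I x -> cutoff t1 p1 x = cutoff t2 p2 x}.
Proof.
move=> /cutoff_solutionP[_ p101 k1] /cutoff_solutionP[_ p201 k2].
have b1 := cutoff_bounded_measurable a b t1 p101.
have b2 := cutoff_bounded_measurable a b t2 p201.
have [c12|c21] := cutoff_total t1 t2 p101 p201.
  by apply: (bounded_integral_eq_le mI (Delta_mass mu)) => //; rewrite k1 k2.
have := bounded_integral_eq_le mI (Delta_mass mu) b2 b1 (fun x _ => c21 x).
by rewrite k1 k2 => /(_ erefl); apply: filterS => x /= + Ix => /(_ Ix) ->.
Qed.

(** Strictly between the cutoffs the two rules take the values 1 and 0. *)
Lemma cutoff_solution_null mu (t1 p1 t2 p2 : R) :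
  cutoff_solution k mu t1 p1 -> cutoff_solution k mu t2 p2 ->
  t1 < t2 -> mu (`]t1, t2[%classic) = 0%E.
Proof.
move=> s1 s2 t12; have := cutoff_solution_ae s1 s2.
move: s1 s2 => /cutoff_solutionP[It1 _ _] /cutoff_solutionP[It2 _ _] ae12.
apply/negligibleP; first exact: measurable_itv.
apply: negligibleS ae12 => x /=; rewrite in_itv/= => /andP[t1x xt2] H.
have /H : I x.
  move: It1 It2; rewrite /= !in_itv/= => /andP[at1 _] /andP[_ t2b].
  by rewrite (le_trans at1) ?(ltW t1x)//= (le_trans (ltW xt2)).
by move/eqP; rewrite /cutoff xt2 ltNge (ltW t1x)/= (gt_eqF t1x) oner_eq0.
Qed.

Lemma cutoff_pointwise_optimum mu (t p : R) (r : R -> R) :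
  {in `[a, b] &, {homo pi : x y / x <= y}} -> cutoff_solution k mu t p ->
  monotone_rule a b r -> E mu r = k ->
  E mu (fun x => r x * pi x) <= E mu (fun x => cutoff t p x * pi x).
Proof.
move=> pih /cutoff_solutionP[It p01 tk] mr rk.
have bc := cutoff_bounded_measurable a b t p01.
have br := monotone_rule_bounded_measurable mr.
apply: (crossing_optimum (l := pi t)) => //; first by rewrite tk.
by move=> x Ix; exact: cutoff_crossing.
Qed.

Lemma cutoff_optimal (t p : Delta ab -> R) :
  {in `[a, b] &, {homo pi : x y / x <= y}} ->
  (forall mu, cutoff_solution k mu (t mu) (p mu)) ->
  optimal k pi M (fun x mu => cutoff (t mu) (p mu) x).
Proof.
move=> pih tp; apply: (two_step_optimal (x' := t) (x'' := t) (p := p)).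
- by move=> mu; have /cutoff_solutionP[_ p01 _] := tp mu.
- by move=> mu x _; rewrite two_step_cutoff.
- by move=> mu; have /cutoff_solutionP[] := tp mu.
- by move=> mu r; exact: cutoff_pointwise_optimum.
Qed.

Lemma cutoff_optimal_unique (t p : Delta ab -> R) q :
  {in `[a, b] &, {homo pi : x y / x < y}} ->
  (forall mu, cutoff_solution k mu (t mu) (p mu)) -> optimal k pi M q ->
  ae_same_rule M q (fun x mu => cutoff (t mu) (p mu) x).
Proof.
move=> pis tp qopt; have pih := ltW_homo_in pis.
apply: (optimal_ae_same_rule (cutoff_optimal pih tp) qopt).
  by move=> mu r; exact: cutoff_pointwise_optimum.
move=> mu r mr rk; have /cutoff_solutionP[It p01 tk] := tp mu.
have bc := cutoff_bounded_measurable a b (t mu) p01.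
have br := monotone_rule_bounded_measurable mr.
apply: (crossing_optimum_unique (c := t mu)) => //; first by rewrite tk.
  by move=> x Ix; exact: cutoff_crossing.
(* Strict monotonicity makes [pi] differ from its value at the cutoff everywhere else. *)
move=> x Ix; case: (ltgtP x (t mu)) => // [xt|tx] _.
  by move/eqP; rewrite lt_eqF// pis.
by move/eqP; rewrite gt_eqF// pis.
Qed.

Lemma integral_constant_rule mu : E mu (fun=> k) = k.
Proof. exact: bounded_integral_cst mI (Delta_mass mu) k. Qed.

Lemma constant_pointwise_optimum mu (r : R -> R) :
  {in `[a, b] &, {homo pi : x y / x <= y >-> y <= x}} ->
  monotone_rule a b r -> E mu r = k ->
  E mu (fun x => r x * pi x) <= E mu (fun x => k * pi x).
Proof.
move=> pih mr rk; have [c Ic cr] := constant_crossing mr pih.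
have br := monotone_rule_bounded_measurable mr.
apply: (crossing_optimum (q := fun=> k) (l := pi c)) => //.
  exact: bounded_measurable_cst.
by rewrite integral_constant_rule.
Qed.

Lemma constant_optimal :
  {in `[a, b] &, {homo pi : x y / x <= y >-> y <= x}} ->
  optimal k pi M (fun _ _ => k).
Proof.
move=> pih; have /andP[k0 k1] := k01.
(* The constant rule is a two-step rule whose flat piece is the whole segment. *)
apply: (two_step_optimal (x' := fun=> a) (x'' := fun=> b) (p := fun=> k)).
- by move=> mu; rewrite ab !ltW.
- by move=> mu x; rewrite /= in_itv/= /two_step => /andP[ax ->];
  rewrite ltNge ax.
- exact: integral_constant_rule.
- by move=> mu r; exact: constant_pointwise_optimum.
Qed.

Lemma constant_optimal_unique q :
  {in `[a, b] &, {homo pi : x y / x < y >-> y < x}} -> optimal k pi M q ->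
  ae_same_rule M q (fun _ _ => k).
Proof.
move=> pis qopt.
have pih : {in `[a, b] &, {homo pi : x y / x <= y >-> y <= x}}.
  by move=> x y Ix Iy; rewrite le_eqVlt => /predU1P[->//|/(pis _ _ Ix Iy)/ltW].
apply: (optimal_ae_same_rule (constant_optimal pih) qopt).
  by move=> mu r; exact: constant_pointwise_optimum.
move=> mu r mr rk; have [c Ic cr] := constant_crossing mr pih.
have br := monotone_rule_bounded_measurable mr.
apply: (crossing_optimum_unique (q := fun=> k) (c := c)) => //.
- exact: bounded_measurable_cst.
- by rewrite integral_constant_rule.
- move=> x Ix; case: (ltgtP x c) => // [xc|cx] _.
    by move/eqP; rewrite gt_eqF// pis.
  by move/eqP; rewrite lt_eqF// pis.
Qed.

Lemma two_step_optimal_exists : exists x' x'' alpha : Delta ab -> R,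
  (forall mu, [/\ x' mu \in `[a, b], x'' mu \in `[a, b], x' mu <= x'' mu &
    alpha mu \in `[0, 1]]) /\
  optimal k pi M (fun x mu => two_step (x' mu) (x'' mu) (alpha mu) x).
Proof.
(* The triple of parameters is chosen separately for each competition. *)
have /choice [s sP] : forall mu, exists s : R * R * R,
    [/\ [/\ I s.1.1, I s.1.2, s.1.1 <= s.1.2 & 0 <= s.2 <= 1],
      E mu (two_step s.1.1 s.1.2 s.2) = k &
      forall r, monotone_rule a b r -> E mu r = k ->
        E mu (fun x => r x * pi x) <=
        E mu (fun x => two_step s.1.1 s.1.2 s.2 x * pi x)].
  move=> mu.
  have [x' [x'' [p H]]] := two_step_optimum_exists mu pi_cont k01.
  by exists (x', x'', p).
exists (fun mu => (s mu).1.1), (fun mu => (s mu).1.2), (fun mu => (s mu).2).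
split=> [mu|]; first by have [[]] := sP mu.
apply: (two_step_optimal (x' := fun mu => (s mu).1.1)
  (x'' := fun mu => (s mu).1.2) (p := fun mu => (s mu).2)) => // mu.
- by have [[]] := sP mu.
- by have [] := sP mu.
- by have [] := sP mu.
Qed.

End optimal_rules.

Theorem theorem3 (R : realType) (a b : R) (ab : a <= b) (k : R)
    (k_gt0 : 0 < k) (k_lt1 : k < 1)
    (pi : R -> R) (pi_cont : {within `[a, b], continuous pi})
    (M : probability (borelDelta ab) R) :
  (* (1) *)
  ({in `[a, b] &, {homo pi : x y / x <= y}} ->
    [/\ forall mu : Delta ab,
          (exists t p : R, cutoff_solution k mu t p) /\
          (forall t1 p1 t2 p2 : R,
            cutoff_solution k mu t1 p1 -> cutoff_solution k mu t2 p2 ->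
            {ae mu, forall x : measurableTypeR R,
               x \in `[a, b] -> cutoff t1 p1 x = cutoff t2 p2 x} /\
            (t1 < t2 -> mu (`]t1, t2[%classic) = 0%E)),
        forall t p : Delta ab -> R,
          (forall mu : Delta ab, cutoff_solution k mu (t mu) (p mu)) ->
          optimal k pi M (fun x mu => cutoff (t mu) (p mu) x) &
        {in `[a, b] &, {homo pi : x y / x < y}} ->
          forall t p : Delta ab -> R,
            (forall mu : Delta ab, cutoff_solution k mu (t mu) (p mu)) ->
            forall q : R -> Delta ab -> R, optimal k pi M q ->
              ae_same_rule M q (fun x mu => cutoff (t mu) (p mu) x)])
  /\
  (* (2) *)
  ({in `[a, b] &, {homo pi : x y / x <= y >-> y <= x}} ->
    optimal k pi M (fun _ _ => k) /\
    ({in `[a, b] &, {homo pi : x y / x < y >-> y < x}} ->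
      forall q : R -> Delta ab -> R, optimal k pi M q ->
        ae_same_rule M q (fun _ _ => k)))
  /\
  (* (3) *)
  (~ {in `[a, b] &, {homo pi : x y / x <= y}} ->
   ~ {in `[a, b] &, {homo pi : x y / x <= y >-> y <= x}} ->
    exists x' x'' alpha : Delta ab -> R,
      (forall mu : Delta ab,
        [/\ x' mu \in `[a, b], x'' mu \in `[a, b], x' mu <= x'' mu &
            alpha mu \in `[0, 1]]) /\
      optimal k pi M (fun x mu => two_step (x' mu) (x'' mu) (alpha mu) x)).
Proof.
have k01 : 0 < k < 1 by rewrite k_gt0 k_lt1.
split; [move=> pih; split|split].
- move=> mu; split=> [|t1 p1 t2 p2 s1 s2].
    have [|t [p tp]] := @cutoff_exists R a b ab mu k; first by rewrite !ltW.
    by exists t, p; apply/cutoff_solutionP.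
  by split; [exact: cutoff_solution_ae s1 s2|exact: cutoff_solution_null s1 s2].
- by move=> t p; exact: cutoff_optimal.
- by move=> pis t p tp q; exact: cutoff_optimal_unique.
- move=> pih; split; first exact: constant_optimal.
  by move=> pis q; exact: constant_optimal_unique.
- by move=> _ _; exact: two_step_optimal_exists.
Qed.
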